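(* For every integer $T\ge 1$, the polynomial $$S_4^{(T)}(z)=z+\sum_{j=2}^{4}\Big(1-\frac{(j-1)T}{1+3T}\Big)\prod_{k=1}^{j-1}\frac{\sin\frac{\pi(2+T(k-1))}{2+3T}}{\sin\frac{\pi Tk}{2+3T}}\,z^{T(j-1)+1}$$ is univalent (i.e. injective) in the open unit disk $\mathbb{D}=\{z\in\mathbb{C}:|z|<1\}$.
   Context: For integers $n\ge 1$ and $T\ge 1$, the $T$-symmetric Suffridge type polynomials are $$S_{n}^{(T)}(z):=z+\sum_{j=2}^n\Big(1-\frac{(j-1)T}{1+(n-1)T}\Big)\prod_{k=1}^{j-1}\frac{\sin\frac{\pi(2+T(k-1))}{2+T(n-1)}}{\sin\frac{\pi Tk}{2+T(n-1)}}z^{T(j-1)+1}.$$ For $n=4$, with $a_T:=\sin\frac{2\pi}{3T+2}\big/\sin\frac{T\pi}{3T+2}$, this takes the form $$S_4^{(T)}(z)=z+\frac{2T+1}{3T+1}a_Tz^{T+1}+\frac{T+1}{3T+1}a_Tz^{2T+1}+\frac{1}{3T+1}z^{3T+1}.$$ *)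

(* Defs.v *)
From mathcomp Require Import all_boot all_order all_algebra.
From mathcomp Require Import all_classical all_reals all_analysis.
From mathcomp Require Import complex.

Set Implicit Arguments.
Unset Strict Implicit.
Unset Printing Implicit Defensive.

Import Order.TTheory GRing.Theory Num.Theory.

Local Open Scope ring_scope.
Local Open Scope complex_scope.

(* In the two definitions below [.-1] is only applied to positive naturals
   (n >= 1, j >= 2, k >= 1), so it never truncates. *)
Definition suffridge_coef (R : realType) (n T j : nat) : R :=
  (1 - (j.-1 * T)%:R / (1 + n.-1 * T)%:R) *
  \prod_(1 <= k < j)
    (sin (pi * (2 + T * k.-1)%:R / (2 + T * n.-1)%:R) /
     sin (pi * (T * k)%:R / (2 + T * n.-1)%:R)).

Definition suffridge (R : realType) (n T : nat) : {poly R[i]} :=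
  'X + \sum_(2 <= j < n.+1) (suffridge_coef R n T j)%:C *: 'X^(T * j.-1 + 1).

Definition univalent_in_unit_disk (R : realType) (f : R[i] -> R[i]) : Prop :=
  {in [pred z : R[i] | `|z| < 1] &, injective f}.

(* Main.v *)
Require Import Defs.
From mathcomp Require Import all_boot all_order all_algebra.
From mathcomp Require Import all_classical all_reals all_analysis.
From mathcomp Require Import complex.
From mathcomp Require Import ring lra.

(** If a polynomial takes the same value twice in the disk, consider a zero
    [(z1, z2)] of its divided difference minimizing [max |z1| |z2|]. Since
    polynomials are open maps, the minimality forces [|z1| = |z2|], so only chords
    of circles [z1, z2 = r e^(i (phi +- x))] matter. With [t = T], [n = 3 t + 1] and
    [a = sin (2 pi / (n + 1)) / sin (t pi / (n + 1)) = 1 + 2 cos (2 pi t / (n + 1))],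
    the polynomial does not separate the ends of such a chord iff
    [w = (r e^(i phi))^T] is a zero of the real cubic
      [n sin x + (2 t + 1) a sin ((t + 1) x) w + (t + 1) a sin ((2 t + 1) x) w^2
       + sin ((3 t + 1) x) w^3].
    By the Schur-Cohn criterion this cubic has no zero in the disk when its
    values at [1] and [-1] and the Schur minor [p0^2 - p3^2 - p0 p2 + p3 p1] are
    nonnegative. The value at [-1] vanishes at [x = 0] and, because of the choice
    of [a], at [x = 2 pi / (n + 1)]; its derivative factors, which gives its
    monotonicity between and after these zeros. For the other two quantities,
    and for [t x >= pi], the inequalities [tan x >= x] and
    [y (2 + cos y) >= 3 sin y] at [y = t x] reduce the claim to polynomial
    inequalities in [cos (t x)]. *)

Set Implicit Arguments.
Unset Strict Implicit.
Unset Printing Implicit Defensive.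

Import Order.TTheory GRing.Theory Num.Theory.
Import numFieldNormedType.Exports.
Local Open Scope ring_scope.
Local Open Scope complex_scope.
Local Open Scope classical_set_scope.

(** * Zeros of real cubics *)

(** A zero [w] makes [p0 V^3 + p1 V^2 + p2 V + p3] vanish at [V = 1 / w], outside the closed disk.
    Dividing out the linear factor of a real root, or the quadratic factor of a conjugate pair,
    factors the Schur minor and contradicts one of the signs. *)
Lemma real_cubic_neq0 (R : rcfType) (p0 p1 p2 p3 : R) (w : R[i]) :
    `|p3| < p0 -> 0 <= p0 + p1 + p2 + p3 -> 0 <= p0 - p1 + p2 - p3 ->
    0 <= p0 ^+ 2 - p3 ^+ 2 - p0 * p2 + p3 * p1 -> `|w| < 1 ->
  p0%:C + p1%:C * w + p2%:C * w ^+ 2 + p3%:C * w ^+ 3 != 0.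
Proof.
move=> /[dup] h1; rewrite ltr_norml => /andP[hN hP] g1 gN1 hphi hw.
apply/eqP => h0.
have w0 : w != 0.
  apply/eqP => w0; move: h0; rewrite w0 !expr0n !mulr0 !addr0 => -[] h0.
  by move: h1; rewrite h0 normr_lt0.
have hv : p0%:C * w^-1 ^+ 3 + p1%:C * w^-1 ^+ 2 + p2%:C * w^-1 + p3%:C = 0.
  apply: (mulIf (expf_neq0 3 w0)); rewrite mul0r -[RHS]h0.
  by field.
have : 1 < `|w^-1| by rewrite normfV invf_gt1 ?normr_gt0.
case: (w^-1) hv => x y hv hxy.
have {}hxy : 1 < x ^+ 2 + y ^+ 2.
  move: hxy; rewrite normc_def /= ltcR => hxy.
  by rewrite -ltr_sqrt ?sqrtr1 // -sqrtr_gt0 (lt_trans ltr01).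
move: hv; rewrite !exprS expr0 !mulr1; simpc => -[hre him].
have p0_gt0 : 0 < p0 by lra.
case: (eqVneq y 0) => [y0|y0].
  move: hre hxy; rewrite y0 => hre hx {him y0}.
  (* The cubic is [(V - x) (p0 V^2 + q1 V + q2)]. *)
  pose q1 := p1 + x * p0; pose q2 := p2 + x * q1.
  have p3E : p3 = - (x * q2) by rewrite /q2 /q1; lra.
  have q2p0 : `|q2| < p0.
    apply: le_lt_trans h1; rewrite p3E normrN normrM ler_peMl //.
    by case: (ger0P x) => ?; nra.
  have hPhi : 0 <= (p0 - q2) * (p0 + x * q1 + x ^+ 2 * q2).
    suff -> : (p0 - q2) * (p0 + x * q1 + x ^+ 2 * q2)
            = p0 ^+ 2 - p3 ^+ 2 - p0 * p2 + p3 * p1 by [].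
    by rewrite p3E /q2 /q1; ring.
  have {}hPhi : 0 <= p0 + x * q1 + x ^+ 2 * q2.
    by move: hPhi; rewrite pmulr_rge0 // subr_gt0; case/ltr_normlP: q2p0.
  have [x1|x1] := leP 0 x.
    have {}x1 : 1 < x by nra.
    have : (1 - x) * (p0 + q1 + q2) >= 0.
      by suff -> : (1 - x) * (p0 + q1 + q2) = p0 + p1 + p2 + p3
        by []; rewrite p3E /q2 /q1; ring.
    rewrite nmulr_rge0 ?subr_lt0 // => h.
    (* Here [p0 + x q1 + x^2 q2 = x (p0 + q1 + q2) - (x - 1) (p0 - x q2)] would be negative, since
       [p0 - x q2 = p0 + p3]. *)
    have : 0 < (x - 1) * (p0 - x * q2) by rewrite mulr_gt0; lra.
    have : x * (p0 + q1 + q2) <= 0 by rewrite pmulr_rle0; lra.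
    lra.
  have {}x1 : x < - 1 by nra.
  have : (1 + x) * (p0 - q1 + q2) >= 0.
    by suff -> : (1 + x) * (p0 - q1 + q2) = p0 - p1 + p2 - p3
      by []; rewrite p3E /q2 /q1; ring.
  rewrite nmulr_rge0; last by lra.
  move=> h.
  have : 0 < (- x - 1) * (p0 + x * q2) by rewrite mulr_gt0; lra.
  have : - x * (p0 - q1 + q2) <= 0 by rewrite pmulr_rle0; lra.
  lra.
have {}him : p2 = - (p1 * x * 2) - p0 * (3 * x ^+ 2 - y ^+ 2).
  by apply: (mulIf y0); lra.
(* The cubic is [(V^2 - 2 x V + x^2 + y^2) (p0 V + k)], and the Schur minor is [1 - x^2 - y^2] times
   the squared modulus of [p0 + k (x + i y)]. *)
pose k := p1 + 2 * x * p0.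
have p3E : p3 = k * (x ^+ 2 + y ^+ 2) by rewrite /k; move: hre; rewrite him; lra.
have p2E : p2 = p0 * (x ^+ 2 + y ^+ 2) - 2 * x * k by rewrite him /k; ring.
have k_gt0 : 0 < (p0 + k * x) ^+ 2 + (k * y) ^+ 2.
  case: (eqVneq k 0) => [->|k0].
    by rewrite !mul0r addr0 expr0n addr0 exprn_gt0.
  by rewrite ltr_wpDl ?sqr_ge0 // exprn_even_gt0 //= mulf_neq0.
have : (1 - (x ^+ 2 + y ^+ 2)) * ((p0 + k * x) ^+ 2 + (k * y) ^+ 2) < 0.
  by rewrite pmulr_llt0 // subr_lt0.
rewrite ltNge => /negP; apply.
suff <- : p0 ^+ 2 - p3 ^+ 2 - p0 * p2 + p3 * p1 =
  (1 - (x ^+ 2 + y ^+ 2)) * ((p0 + k * x) ^+ 2 + (k * y) ^+ 2) by [].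
by rewrite p3E p2E /k; ring.
Qed.

(** * Trigonometric inequalities *)

Section real_trigo.
Variable R : realType.
Implicit Types x y k : R.

Section derive_fun.
Variables (f g : R -> R) (x df dg : R).
Hypotheses (fdf : is_derive x 1 f df) (gdg : is_derive x 1 g dg).

Lemma is_derive1D : is_derive x 1 (fun t => f t + g t) (df + dg).
Proof. exact: is_deriveD. Qed.

Lemma is_derive1B : is_derive x 1 (fun t => f t - g t) (df - dg).
Proof. exact: is_deriveB. Qed.

Lemma is_derive1M : is_derive x 1 (fun t => f t * g t) (f x * dg + g x * df).
Proof. exact: is_deriveM. Qed.

Lemma is_derive1Z k : is_derive x 1 (fun t => k * f t) (k * df).
Proof. exact: is_deriveZ. Qed.

End derive_fun.

Lemma is_derive1X n x : is_derive x 1 (fun t => t ^+ n) (n%:R * x ^+ n.-1).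
Proof.
elim: n => [|n IHn].
  under eq_fun do rewrite expr0.
  rewrite mul0r; exact: is_derive_cst.
under eq_fun do rewrite exprS.
apply: (is_derive_eq (is_derive1M (is_derive_id x 1) IHn)) => /=.
by case: n {IHn} => [|n]; rewrite /= ?exprS -!natr1; ring.
Qed.

Lemma is_derive_sinZ k x :
  is_derive x 1 (fun t => sin (k * t)) (k * cos (k * x)).
Proof.
apply: (is_derive_eq (is_derive1_comp (is_derive_sin (k * x))
  (is_derive1Z (is_derive_id x 1) k))).
by rewrite mulr1 mulrC.
Qed.

Lemma derive_ge0_le (f df : R -> R) (a b : R) : a <= b ->
  (forall x, is_derive x 1 f (df x)) ->
  (forall x, a <= x <= b -> 0 <= df x) -> f a <= f b.
Proof.
rewrite le_eqVlt => /predU1P[-> //|ab] fdf df0.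
have cf : {within `[a, b], continuous f}.
  apply: continuous_subspaceT => x; apply: differentiable_continuous.
  by apply/derivable1_diffP; case: (fdf x).
have [x xab fE] := MVT ab (fun x _ => fdf x) cf.
rewrite -subr_ge0 fE mulr_ge0 ?subr_ge0 ?(ltW ab) // df0 //.
by move: xab; rewrite in_itv /= => /andP[/ltW-> /ltW->].
Qed.

Lemma sin_le_id x : 0 <= x -> sin x <= x.
Proof.
move=> x0.
have df y : is_derive y 1 (fun t : R => t - sin t) (1 - cos y).
  exact: is_derive1B (is_derive_id y 1) (is_derive_sin y).
have : 0 - sin 0 <= x - sin x.
  by apply: derive_ge0_le df _.
rewrite sin0; lra.
Qed.

(** From here to the quintic bound, each Taylor estimate integrates the preceding one from 0. *)
Lemma cos_ge_quadratic x : 0 <= x -> 1 - x ^+ 2 / 2 <= cos x.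
Proof.
move=> x0.
have df y : is_derive y 1 (fun t : R => cos t + 2^-1 * t ^+ 2) (y - sin y).
  apply: (is_derive_eq (is_derive1D (is_derive_cos y)
    (is_derive1Z (is_derive1X 2 y) 2^-1))).
  by rewrite /=; lra.
have : cos 0 + 2^-1 * 0 ^+ 2 <= cos x + 2^-1 * x ^+ 2.
  apply: derive_ge0_le df _ => // y /andP[y0 _].
  by rewrite /= subr_ge0 sin_le_id.
rewrite cos0; lra.
Qed.

Lemma sin_ge_cubic x : 0 <= x -> x - x ^+ 3 / 6 <= sin x.
Proof.
move=> x0.
have df y : is_derive y 1 (fun t : R => sin t - t + 6^-1 * t ^+ 3)
    (cos y - (1 - y ^+ 2 / 2)).
  apply: (is_derive_eq (is_derive1D (is_derive1B (is_derive_sin y)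
    (is_derive_id y 1)) (is_derive1Z (is_derive1X 3 y) 6^-1))).
  by rewrite /=; lra.
have : sin 0 - 0 + 6^-1 * 0 ^+ 3 <= sin x - x + 6^-1 * x ^+ 3.
  apply: derive_ge0_le df _ => // y /andP[y0 _].
  by rewrite /= subr_ge0 cos_ge_quadratic.
rewrite sin0; lra.
Qed.

Lemma cos_le_quartic x : 0 <= x -> cos x <= 1 - x ^+ 2 / 2 + x ^+ 4 / 24.
Proof.
move=> x0.
have df y : is_derive y 1 (fun t : R => 24^-1 * t ^+ 4 - 2^-1 * t ^+ 2 - cos t)
    (sin y - (y - y ^+ 3 / 6)).
  apply: (is_derive_eq (is_derive1B (is_derive1B
    (is_derive1Z (is_derive1X 4 y) 24^-1) (is_derive1Z (is_derive1X 2 y) 2^-1))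
    (is_derive_cos y))).
  by rewrite /=; lra.
have : 24^-1 * 0 ^+ 4 - 2^-1 * 0 ^+ 2 - cos 0 <=
       24^-1 * x ^+ 4 - 2^-1 * x ^+ 2 - cos x.
  apply: derive_ge0_le df _ => // y /andP[y0 _].
  by rewrite /= subr_ge0 sin_ge_cubic.
rewrite cos0; lra.
Qed.

Lemma sin_le_quintic x : 0 <= x -> sin x <= x - x ^+ 3 / 6 + x ^+ 5 / 120.
Proof.
move=> x0.
have df y : is_derive y 1 (fun t : R => t - 6^-1 * t ^+ 3 + 120^-1 * t ^+ 5 - sin t)
    (1 - y ^+ 2 / 2 + y ^+ 4 / 24 - cos y).
  apply: (is_derive_eq (is_derive1B (is_derive1D (is_derive1B (is_derive_id y 1)
    (is_derive1Z (is_derive1X 3 y) 6^-1)) (is_derive1Z (is_derive1X 5 y) 120^-1))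
    (is_derive_sin y))).
  by rewrite /=; lra.
have : 0 - 6^-1 * 0 ^+ 3 + 120^-1 * 0 ^+ 5 - sin 0 <=
       x - 6^-1 * x ^+ 3 + 120^-1 * x ^+ 5 - sin x.
  apply: derive_ge0_le df _ => // y /andP[y0 _].
  by rewrite /= subr_ge0 cos_le_quartic.
rewrite sin0; lra.
Qed.

(** This is [tan x >= x] freed of division; the difference has derivative [x sin x]. *)
Lemma mul_cos_le_sin x : 0 <= x <= pi -> x * cos x <= sin x.
Proof.
move=> /andP[x0 xpi].
have df y : is_derive y 1 (fun t : R => sin t - t * cos t) (y * sin y).
  apply: (is_derive_eq (is_derive1B (is_derive_sin y)
    (is_derive1M (is_derive_id y 1) (is_derive_cos y)))).
  by rewrite /=; lra.
have : sin 0 - 0 * cos 0 <= sin x - x * cos x.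
  apply: derive_ge0_le df _ => // y /andP[y0 yx].
  by rewrite mulr_ge0 // sin_ge0_pi // y0 (le_trans yx).
rewrite sin0; lra.
Qed.

(** The Cusa-Huygens inequality: two differentiations reduce it to [x cos x <= sin x]. *)
Lemma sin_le_cusa x : 0 <= x <= pi -> 3 * sin x <= x * (2 + cos x).
Proof.
move=> /andP[x0 xpi].
have dg y : is_derive y 1 (fun t : R => - 2 * cos t - t * sin t)
    (sin y - y * cos y).
  apply: (is_derive_eq (is_derive1B (is_derive1Z (is_derive_cos y) (- 2))
    (is_derive1M (is_derive_id y 1) (is_derive_sin y)))).
  by rewrite /=; lra.
have df y : is_derive y 1 (fun t : R => 2 * t + t * cos t - 3 * sin t)
    (2 - 2 * cos y - y * sin y).
  apply: (is_derive_eq (is_derive1B (is_derive1D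
    (is_derive1Z (is_derive_id y 1) 2)
    (is_derive1M (is_derive_id y 1) (is_derive_cos y)))
    (is_derive1Z (is_derive_sin y) 3))).
  by rewrite /=; lra.
have : 2 * 0 + 0 * cos 0 - 3 * sin 0 <= 2 * x + x * cos x - 3 * sin x.
  apply: derive_ge0_le df _ => // y /andP[y0 yx].
  have : - 2 * cos 0 - 0 * sin 0 <= - 2 * cos y - y * sin y.
    apply: derive_ge0_le dg _ => // z /andP[z0 zy].
    by rewrite /= subr_ge0 mul_cos_le_sin // z0 (le_trans zy) // (le_trans yx).
  rewrite cos0; lra.
rewrite sin0; lra.
Qed.

Lemma sin_pi6 : sin (pi / 6) = 1 / 2 :> R.
Proof.
have pi0 := pi_gt0 R.
have s0 : 0 < sin (pi / 6) :> R by apply: sin_gt0_pi; lra.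
have : sin (pi / 6 + pi / 6 + pi / 6) = 1 :> R.
  have -> : pi / 6 + pi / 6 + pi / 6 = pi / 2 :> R by lra.
  exact: sin_pihalf.
rewrite !sinD !cosD => h1.
(* The triple-angle formula at [pi / 6], in factored form. *)
have : (sin (pi / 6) + 1) * (2 * sin (pi / 6) - 1) ^+ 2 = 0 :> R.
  have hc := cos2sin2 (pi / 6 : R); move: s0 h1 hc.
  move: (sin _) (cos _) => s c _ h1 hc.
  have : 3 * c ^+ 2 * s - s ^+ 3 = 1 by lra.
  by rewrite hc; lra.
move/eqP; rewrite mulf_eq0 sqrf_eq0 => /orP[] /eqP; lra.
Qed.

Lemma pi_ge3 : 3 <= pi :> R.
Proof.
have pi0 := pi_ge0 R.
have : sin (pi / 6) <= pi / 6 :> R by apply: sin_le_id; lra.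
rewrite sin_pi6; lra.
Qed.

Lemma pi_le315 : pi <= 63 / 20 :> R.
Proof.
have pi0 := pi_ge3; have pi4 := pihalf_lt2 R.
have : pi / 6 - (pi / 6) ^+ 3 / 6 <= sin (pi / 6) :> R by apply: sin_ge_cubic; lra.
rewrite sin_pi6 => h; rewrite leNgt; apply/negP => hpi.
set x : R := pi / 6 in h; have xE : pi = 6 * x by rewrite /x; lra.
(* Six times the increment of [x - x^3 / 6] from [21 / 40], where this function already exceeds
   [1 / 2]. *)
have : 0 < (x - 21 / 40) * (6 - (x ^+ 2 + 21 / 40 * x + (21 / 40) ^+ 2)).
  by apply: mulr_gt0; [lra|nra].
lra.
Qed.
End real_trigo.

(** * Polynomial inequalities *)

Section algebraic_bounds.
Variable R : realFieldType.
Implicit Types T a c l m s t u v x y : R.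

Definition sextic a0 a1 a2 a3 a4 a5 a6 x : R :=
  a0 + a1 * x + a2 * x ^+ 2 + a3 * x ^+ 3 + a4 * x ^+ 4 + a5 * x ^+ 5
  + a6 * x ^+ 6.

(* The hypotheses are the Bernstein coefficients of the polynomial on [[0, 1]]. *)
Lemma sextic_ge0_01 a0 a1 a2 a3 a4 a5 a6 x : 0 <= x -> x <= 1 ->
    0 <= a0 ->
    0 <= 6 * a0 + a1 ->
    0 <= 15 * a0 + 5 * a1 + a2 ->
    0 <= 20 * a0 + 10 * a1 + 4 * a2 + a3 ->
    0 <= 15 * a0 + 10 * a1 + 6 * a2 + 3 * a3 + a4 ->
    0 <= 6 * a0 + 5 * a1 + 4 * a2 + 3 * a3 + 2 * a4 + a5 ->
    0 <= a0 + a1 + a2 + a3 + a4 + a5 + a6 ->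
  0 <= sextic a0 a1 a2 a3 a4 a5 a6 x.
Proof.
move=> x0; rewrite -subr_ge0 => x1 b0 b1 b2 b3 b4 b5 b6.
have b k b : 0 <= b -> 0 <= b * (x ^+ k * (1 - x) ^+ (6 - k)).
  by move=> ?; rewrite mulr_ge0 // mulr_ge0 // exprn_ge0.
have -> : sextic a0 a1 a2 a3 a4 a5 a6 x =
  a0 * (x ^+ 0 * (1 - x) ^+ 6)
  + (6 * a0 + a1) * (x ^+ 1 * (1 - x) ^+ 5)
  + (15 * a0 + 5 * a1 + a2) * (x ^+ 2 * (1 - x) ^+ 4)
  + (20 * a0 + 10 * a1 + 4 * a2 + a3) * (x ^+ 3 * (1 - x) ^+ 3)
  + (15 * a0 + 10 * a1 + 6 * a2 + 3 * a3 + a4) * (x ^+ 4 * (1 - x) ^+ 2)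
  + (6 * a0 + 5 * a1 + 4 * a2 + 3 * a3 + 2 * a4 + a5) * (x ^+ 5 * (1 - x) ^+ 1)
  + (a0 + a1 + a2 + a3 + a4 + a5 + a6) * (x ^+ 6 * (1 - x) ^+ 0).
  by rewrite /sextic; ring.
by rewrite !addr_ge0 // (b _ _) //.
Qed.

(** Each half of the interval has its own Bernstein certificate, the left one after the reflection
    [x -> - x]. In the uses below the coefficients are affine in the parameters, so the conditions
    are linear. *)
Lemma sextic_ge0 a0 a1 a2 a3 a4 a5 a6 x : -1 <= x <= 1 ->
    0 <= a0 ->
    0 <= 6 * a0 + a1 ->
    0 <= 15 * a0 + 5 * a1 + a2 ->
    0 <= 20 * a0 + 10 * a1 + 4 * a2 + a3 ->
    0 <= 15 * a0 + 10 * a1 + 6 * a2 + 3 * a3 + a4 ->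
    0 <= 6 * a0 + 5 * a1 + 4 * a2 + 3 * a3 + 2 * a4 + a5 ->
    0 <= a0 + a1 + a2 + a3 + a4 + a5 + a6 ->
    0 <= 6 * a0 - a1 ->
    0 <= 15 * a0 - 5 * a1 + a2 ->
    0 <= 20 * a0 - 10 * a1 + 4 * a2 - a3 ->
    0 <= 15 * a0 - 10 * a1 + 6 * a2 - 3 * a3 + a4 ->
    0 <= 6 * a0 - 5 * a1 + 4 * a2 - 3 * a3 + 2 * a4 - a5 ->
    0 <= a0 - a1 + a2 - a3 + a4 - a5 + a6 ->
  0 <= sextic a0 a1 a2 a3 a4 a5 a6 x.
Proof.
move=> /andP[xN1 x1] *; have [x0|x0] := leP 0 x; first exact: sextic_ge0_01.
have -> : sextic a0 a1 a2 a3 a4 a5 a6 x =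
    sextic a0 (- a1) a2 (- a3) a4 (- a5) a6 (- x).
  by rewrite /sextic; ring.
by apply: sextic_ge0_01; lra.
Qed.

Let cubic_ge0 t x0 x1 x2 x3 : 0 <= t -> 0 <= x0 -> 0 <= x1 -> 0 <= x2 ->
  0 <= x3 -> 0 <= x0 + t * x1 + t ^+ 2 * x2 + t ^+ 3 * x3.
Proof. by move=> *; rewrite !addr_ge0 // mulr_ge0 // exprn_ge0. Qed.

(* With [c = cos (T x)], these are the coefficients of the Schur minor as a
   quadratic form in [sin x] and [cos x * sin (T x)]. *)
Definition schurA T a c : R := (3 * T + 1) ^+ 2 - (4 * c ^+ 3 - 3 * c) ^+ 2
  - (3 * T + 1) * (T + 1) * a * (2 * c ^+ 2 - 1)
  + (2 * T + 1) * a * (4 * c ^+ 3 - 3 * c) * c.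
Definition schurB T a c : R := - 2 * (4 * c ^+ 3 - 3 * c) * (4 * c ^+ 2 - 1)
  - 2 * (3 * T + 1) * (T + 1) * a * c + (2 * T + 1) * a * (8 * c ^+ 3 - 4 * c).
Definition schurC T a c : R :=
  - (4 * c ^+ 2 - 1) ^+ 2 + (2 * T + 1) * a * (4 * c ^+ 2 - 1).

(* The polynomials [schur*_coef*] below are the coefficients of the powers of
   [T - 2] in [2 T + 1] times the quantity to be bounded, [l] standing for
   [(2 T + 1) a]; for [schurABC] a factor [1 - c] is divided out first. *)
Let schurA_coef0 l c : 3 <= l -> l <= 51 / 10 -> -1 <= c <= 1 ->
  0 <= sextic (245 + 21 * l) 0 (- 45 - 57 * l) 0 (120 + 20 * l) 0 (- 80) c.
Proof. by move=> l3 l5 hc; apply: sextic_ge0; lra. Qed.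

Let schurA_coef1 l c : 3 <= l -> l <= 51 / 10 -> -1 <= c <= 1 ->
  0 <= sextic (308 + 16 * l) 0 (- 18 - 38 * l) 0 (48 + 8 * l) 0 (- 32) c.
Proof. by move=> l3 l5 hc; apply: sextic_ge0; lra. Qed.

Let schurA_coef2 l c : 3 <= l -> l <= 51 / 10 -> -1 <= c <= 1 ->
  0 <= sextic (129 + 3 * l) 0 (- 6 * l) 0 0 0 0 c.
Proof. by move=> l3 l5 hc; apply: sextic_ge0; lra. Qed.

Let schurA_coef3 l c : 3 <= l -> l <= 51 / 10 -> -1 <= c <= 1 ->
  0 <= sextic 18 0 0 0 0 0 0 c.
Proof. by move=> l3 l5 hc; apply: sextic_ge0; lra. Qed.

(** Let the Schur minor be [A X^2 + B X Y + C Y^2], and put [q = T (2 + c)], [q X = h + 3 Y].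
    Multiplied by [q^2], it has coefficients [A], [6 A + q B] and [9 A + 3 q B + q^2 C] at [h^2],
    [h Y] and [Y^2]; these are treated here and in [schurAB_ge0] and [schurABC_ge0]. *)
Lemma schurA_ge0 T a c :
    2 <= T -> 3 <= (2 * T + 1) * a <= 51 / 10 -> -1 <= c <= 1 ->
  0 <= schurA T a c.
Proof.
move=> hT /andP[l3 l5] hc.
have t0 : 0 <= T - 2 by lra.
have T0 : 0 < 2 * T + 1 by lra.
(* The factor [2 T + 1] makes the quantity a polynomial in [T - 2], [c] and [l = (2 T + 1) a]. *)
rewrite -(pmulr_rge0 _ T0).
have := cubic_ge0 t0 (schurA_coef0 l3 l5 hc) (schurA_coef1 l3 l5 hc)
  (schurA_coef2 l3 l5 hc) (schurA_coef3 l3 l5 hc).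
by congr (_ <= _); rewrite /sextic /schurA /schurB /schurC; ring.
Qed.

Let schurAB_coef0 l c : 3 <= l -> l <= 51 / 10 -> -1 <= c <= 1 ->
  0 <= sextic (1470 + 126 * l) (- 120 - 248 * l) (- 330 - 466 * l)
    (640 + 160 * l) (1040 + 200 * l) (- 640) (- 800) c.
Proof. by move=> l3 l5 hc; apply: sextic_ge0; lra. Qed.

Let schurAB_coef1 l c : 3 <= l -> l <= 51 / 10 -> -1 <= c <= 1 ->
  0 <= sextic (1848 + 96 * l) (- 108 - 284 * l) (- 162 - 370 * l)
    (576 + 144 * l) (576 + 120 * l) (- 576) (- 480) c.
Proof. by move=> l3 l5 hc; apply: sextic_ge0; lra. Qed.

Let schurAB_coef2 l c : 3 <= l -> l <= 51 / 10 -> -1 <= c <= 1 ->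
  0 <= sextic (774 + 18 * l) (- 24 - 104 * l) (- 12 - 88 * l) (128 + 32 * l)
    (64 + 16 * l) (- 128) (- 64) c.
Proof. by move=> l3 l5 hc; apply: sextic_ge0; lra. Qed.

Let schurAB_coef3 l c : 3 <= l -> l <= 51 / 10 -> -1 <= c <= 1 ->
  0 <= sextic 108 (- 12 * l) (- 6 * l) 0 0 0 0 c.
Proof. by move=> l3 l5 hc; apply: sextic_ge0; lra. Qed.

Lemma schurAB_ge0 T a c :
    2 <= T -> 3 <= (2 * T + 1) * a <= 51 / 10 -> -1 <= c <= 1 ->
  0 <= schurB T a c * T * (2 + c) + 6 * schurA T a c.
Proof.
move=> hT /andP[l3 l5] hc.
have t0 : 0 <= T - 2 by lra.
have T0 : 0 < 2 * T + 1 by lra.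
rewrite -(pmulr_rge0 _ T0).
have := cubic_ge0 t0 (schurAB_coef0 l3 l5 hc) (schurAB_coef1 l3 l5 hc)
  (schurAB_coef2 l3 l5 hc) (schurAB_coef3 l3 l5 hc).
by congr (_ <= _); rewrite /sextic /schurA /schurB /schurC; ring.
Qed.

Let schurABC_coef0 l c : 3 <= l -> l <= 51 / 10 -> -1 <= c <= 1 ->
  0 <= sextic (2125 + 109 * l) (1685 - 715 * l) (1720 - 1300 * l)
    (4280 - 500 * l) 5200 2000 0 c.
Proof. by move=> l3 l5 hc; apply: sextic_ge0; lra. Qed.

Let schurABC_coef1 l c : 3 <= l -> l <= 51 / 10 -> -1 <= c <= 1 ->
  0 <= sextic (2660 + 32 * l) (2224 - 932 * l) (2768 - 1280 * l)
    (5392 - 400 * l) 5120 1600 0 c.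
Proof. by move=> l3 l5 hc; apply: sextic_ge0; lra. Qed.

Let schurABC_coef2 l c : 3 <= l -> l <= 51 / 10 -> -1 <= c <= 1 ->
  0 <= sextic (1109 - 25 * l) (985 - 389 * l) (1352 - 404 * l) (2152 - 100 * l)
    1616 400 0 c.
Proof. by move=> l3 l5 hc; apply: sextic_ge0; lra. Qed.

Let schurABC_coef3 l c : 3 <= l -> l <= 51 / 10 -> -1 <= c <= 1 ->
  0 <= sextic (154 - 8 * l) (146 - 52 * l) (208 - 40 * l) (272 - 8 * l) 160 32
    0 c.
Proof. by move=> l3 l5 hc; apply: sextic_ge0; lra. Qed.

Lemma schurABC_ge0 T a c :
    2 <= T -> 3 <= (2 * T + 1) * a <= 51 / 10 -> -1 <= c <= 1 ->
  0 <= 9 * schurA T a c + 3 * schurB T a c * T * (2 + c)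
     + schurC T a c * T ^+ 2 * (2 + c) ^+ 2.
Proof.
move=> hT /andP[l3 l5] hc.
have t0 : 0 <= T - 2 by lra.
have T0 : 0 < 2 * T + 1 by lra.
have c0 : 0 <= 1 - c by lra.
rewrite -(pmulr_rge0 _ T0).
have := cubic_ge0 t0 (schurABC_coef0 l3 l5 hc) (schurABC_coef1 l3 l5 hc)
  (schurABC_coef2 l3 l5 hc) (schurABC_coef3 l3 l5 hc).
move/(mulr_ge0 c0).
by congr (_ <= _); rewrite /sextic /schurA /schurB /schurC; ring.
Qed.

(** The ratio [(T + 1) / (2 T + 1)] decreases from [3 / 5] at [T = 2] towards [1 / 2]. This bounds
    [m = (T + 1) a] linearly by [l = (2 T + 1) a]. *)
Let slope_bounds T a : 2 <= T -> 3 <= (2 * T + 1) * a ->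
  (2 * T + 1) * a / 2 <= (T + 1) * a <= 3 / 5 * ((2 * T + 1) * a).
Proof.
move=> hT h; have a0 : 0 <= a.
  by rewrite -(pmulr_rge0 _ (_ : 0 < 2 * T + 1)); lra.
have : 0 <= (T - 2) * a by apply: mulr_ge0 => //; lra.
lra.
Qed.

(* With [c = cos (T x)], the cubic of a chord takes at [1] the value
   [sin x * rayX T a c + cos x * sin (T x) * rayY T a c], and at [-1] the value
   [sin x * rayX T a (- c) - cos x * sin (T x) * rayY T a (- c)]. *)
Definition rayX T a c : R :=
  3 * T + 1 + (2 * T + 1) * a * c + (T + 1) * a * (2 * c ^+ 2 - 1)
  + (4 * c ^+ 3 - 3 * c).
Definition rayY T a c : R :=
  (2 * T + 1) * a + 2 * (T + 1) * a * c + (4 * c ^+ 2 - 1).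

Lemma rayX_ge0 T a c : 2 <= T -> 3 <= (2 * T + 1) * a <= 51 / 10 ->
  -1 <= c <= 1 -> 0 <= rayX T a c.
Proof.
move=> hT /andP[l3 l5] hc; have /andP[] := slope_bounds hT l3.
rewrite /rayX; set l := (2 * T + 1) * a in l3 l5 *; set m := (T + 1) * a.
move=> m1 m2.
have : 0 <= sextic (7 - m) (l - 3) (2 * m) 4 0 0 0 c by apply: sextic_ge0; lra.
by rewrite /sextic; lra.
Qed.

Lemma rayY_ge0 T a c : 2 <= T -> 3 <= (2 * T + 1) * a <= 51 / 10 ->
  -1 <= c <= 1 -> 0 <= rayY T a c.
Proof.
move=> hT /andP[l3 l5] hc; have /andP[] := slope_bounds hT l3.
rewrite /rayY -[2 * (T + 1) * a]mulrA; set l := (2 * T + 1) * a in l3 l5 *.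
set m := (T + 1) * a => m1 m2.
have : 0 <= sextic (l - 1) (2 * m) 4 0 0 0 0 c by apply: sextic_ge0; lra.
by rewrite /sextic; lra.
Qed.

(** Together with [3 cos x <= T sin x], this lets the [rayX] term absorb the [rayY] term whatever
    the sign of [s]. *)
Lemma ray_le T a c s : 2 <= T -> 3 <= (2 * T + 1) * a <= 51 / 10 ->
  c ^+ 2 + s ^+ 2 = 1 -> T * (`|s| * rayY T a c) <= 3 * rayX T a c.
Proof.
move=> hT hl cs.
have hc : -1 <= c <= 1 by have := sqr_ge0 s; nra.
have Y0 := rayY_ge0 hT hl hc; have /andP[l3 l5] := hl.
(* Expanding [(|s| - 3 / 4)^2 >= 0] replaces [|s|] by a polynomial in [c]. *)
have hs : `|s| <= 2 / 3 * (25 / 16 - c ^+ 2).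
  have : `|s| ^+ 2 = 1 - c ^+ 2 by rewrite real_normK ?num_real //; lra.
  by have := sqr_ge0 (`|s| - 3 / 4); lra.
have h : `|s| * rayY T a c <= 2 / 3 * (25 / 16 - c ^+ 2) * rayY T a c.
  exact: ler_wpM2r.
apply: le_trans (_ : T * (2 / 3 * (25 / 16 - c ^+ 2) * rayY T a c) <= _).
  by rewrite ler_pM2l //; lra.
have /andP[] := slope_bounds hT l3.
rewrite /rayY /rayX -[2 * (T + 1) * a]mulrA; set l := (2 * T + 1) * a in l3 l5 *.
set m := (T + 1) * a => m1 m2.
(* For fixed [l] and [m] the difference of the two sides is affine in [T]: [p1] concerns its slope
   and [p2] its value at [T = 2]. *)
have p1 : 0 <= sextic (9 - 25 / 24 * (l - 1)) (- (25 / 12) * m)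
    (2 / 3 * (l - 1) - 25 / 6) (4 / 3 * m) (8 / 3) 0 0 c.
  by apply: sextic_ge0; lra.
have p2 : 0 <= sextic (21 - 25 / 12 * (l - 1) - 3 * m)
    (3 * l - 9 - 25 / 6 * m) (4 / 3 * (l - 1) + 6 * m - 25 / 3)
    (8 / 3 * m + 12) (16 / 3) 0 0 c.
  by apply: sextic_ge0; lra.
have t0 : 0 <= T - 2 by lra.
rewrite -subr_ge0; have := addr_ge0 (mulr_ge0 t0 p1) p2.
by congr (_ <= _); rewrite /sextic; field.
Qed.

End algebraic_bounds.

(** * Bounds on the coefficient constant *)

Section suffridge_constant.
Variable R : realType.
Implicit Types t : R.

Definition suffridge_a t : R := 1 + 2 * cos (2 * pi * t / (3 * t + 2)).

(* With [d = 4 pi / (9 t + 6)] the angle is [2 pi / 3 - d], and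
   [(2 t + 1) d = 8 pi / 9 - d / 3]. *)
Lemma suffridge_a_bounds t : 1 <= t ->
  3 <= (2 * t + 1) * suffridge_a t <= 51 / 10.
Proof.
move=> t1; have pi3 := pi_ge3 R; have pi4 := pi_le315 R.
pose d : R := 4 * pi / (9 * t + 6).
have d0 : 0 < d by rewrite divr_gt0; lra.
have dE : d * (9 * t + 6) = 4 * pi by rewrite divfK //; lra.
have d1 : d <= 21 / 25.
  rewrite ler_pdivrMr; lra.
have tE : (2 * t + 1) * d = 8 / 9 * pi - d / 3 by lra.
have k0 : 0 < cos (pi / 6) :> R by apply: cos_gt0_pihalf; lra.
have k2 : cos (pi / 6) ^+ 2 = 3 / 4 :> R by rewrite cos2sin2 sin_pi6; lra.
(* This expands [1 + 2 cos (2 pi / 3 - d)]; [2 cos (pi / 6)] is the square root of 3, enclosed below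
   between [17 / 10] and [26 / 15]. *)
have aE : suffridge_a t = 1 - cos d + 2 * cos (pi / 6) * sin d.
  rewrite /suffridge_a.
  have -> : 2 * pi * t / (3 * t + 2) = (pi / 6 + pi / 2) - d.
    by rewrite /d; field; rewrite !gt_eqF //; lra.
  by rewrite cosB cosDpihalf sinDpihalf sin_pi6; lra.
move: (cos (pi / 6)) k0 k2 aE => k k0 k2 aE.
have k_ge : 17 / 10 <= k * 2 by nra.
have k_le : k * 2 <= 26 / 15 by nra.
have s_ge := sin_ge_cubic (ltW d0); have s_le := sin_le_quintic (ltW d0).
have c_ge := cos_ge_quadratic (ltW d0); have c_le := cos_le1 d.
apply/andP; split.
  have s0 : 22 / 25 * d <= sin d by nra.
  have : 17 / 10 * (22 / 25 * d) <= k * 2 * sin d by nra.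
  nra.
have s0 : 0 <= sin d by nra.
(* The factor [d] stays outside, to be merged with [2 t + 1] into
   [8 pi / 9 - d / 3 <= 14 / 5 - d / 3]. *)
have a_le : suffridge_a t <=
    d * (d / 2 + 26 / 15 * (1 - d ^+ 2 / 6 + d ^+ 4 / 120)).
  have : k * 2 * sin d <= 26 / 15 * (d - d ^+ 3 / 6 + d ^+ 5 / 120) by nra.
  lra.
apply: le_trans (_ : (2 * t + 1) *
  (d * (d / 2 + 26 / 15 * (1 - d ^+ 2 / 6 + d ^+ 4 / 120))) <= _).
  by rewrite ler_pM2l //; lra.
rewrite mulrA tE.
apply: le_trans (_ : (14 / 5 - d / 3) *
  (d / 2 + 26 / 15 * (1 - d ^+ 2 / 6 + d ^+ 4 / 120)) <= _).
  by apply: ler_wpM2r; nra.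
(* This polynomial is [51 / 10] minus the product to be bounded. *)
have : 0 <= sextic (37 / 150) (- (37 / 45)) (437 / 450) (- (13 / 135))
    (- (91 / 2250)) (13 / 2700) 0 d.
  by apply: sextic_ge0_01; lra.
rewrite /sextic; lra.
Qed.
End suffridge_constant.

(** * The cubic of a chord *)

Section rays.
Variable R : realType.
Implicit Types t a x y : R.

(** The addition formula for [k t x + x], with Chebyshev polynomials in [cos (t x)] for the multiple
    angles. *)
Lemma sin_multiples t x :
  [/\ sin ((t + 1) * x) = sin x * cos (t * x) + cos x * sin (t * x),
      sin ((2 * t + 1) * x) = sin x * (2 * cos (t * x) ^+ 2 - 1)
        + cos x * sin (t * x) * (2 * cos (t * x)) &
      sin ((3 * t + 1) * x) = sin x * (4 * cos (t * x) ^+ 3 - 3 * cos (t * x))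
        + cos x * sin (t * x) * (4 * cos (t * x) ^+ 2 - 1)].
Proof.
have s2 := sin2cos2 (t * x).
have e2 : (2 * t + 1) * x = t * x + t * x + x by ring.
have e3 : (3 * t + 1) * x = t * x + t * x + t * x + x by ring.
split; first by rewrite mulrDl mul1r sinD; ring.
  rewrite e2 !(sinD, cosD); move: s2; move: (sin (t * x)) (cos (t * x)) => s c s2.
  rewrite -expr2 -expr2 s2; ring.
rewrite e3 !(sinD, cosD); move: s2; move: (sin (t * x)) (cos (t * x)) => s c s2.
apply: etrans (_ : s * (3 * c ^+ 2 - s ^+ 2) * cos x
  + c * (c ^+ 2 - 3 * s ^+ 2) * sin x = _); first by ring.
by rewrite s2; ring.
Qed.

(** Multiply [x cos x <= sin x] by [t] and use [t x >= pi >= 3]. *)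
Lemma sin_ge_cos_ray t x : 0 <= t -> 0 <= x <= pi / 2 -> pi <= t * x ->
  3 * cos x <= t * sin x.
Proof.
move=> t0 /andP[x0 x1] h; have pi3 := pi_ge3 R.
have k0 : 0 <= cos x by apply: cos_ge0_pihalf; lra.
have h1 : x * cos x <= sin x by apply: mul_cos_le_sin; lra.
have h2 : t * (x * cos x) <= t * sin x by rewrite ler_wpM2l.
have h3 : 3 * cos x <= (t * x) * cos x by rewrite ler_wpM2r //; lra.
by move: h2; rewrite mulrA; lra.
Qed.

Let cos_itv x : -1 <= cos x <= 1. Proof. by rewrite cos_geN1 cos_le1. Qed.

(** The point [(c, s)] is left free on the unit circle so that both [(cos (t x), sin (t x))] and its
    opposite are covered. *)
Let ray_dominated t a x c s : 2 <= t -> 3 <= (2 * t + 1) * a <= 51 / 10 ->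
  0 <= x <= pi / 2 -> pi <= t * x ->
  c ^+ 2 + s ^+ 2 = 1 -> 0 <= sin x * rayX t a c + cos x * s * rayY t a c.
Proof.
move=> t2 al hx h cs.
have k0 : 0 <= cos x by apply: cos_ge0_pihalf; have := pi_ge3 R; lra.
have hc : -1 <= c <= 1 by have := sqr_ge0 s; nra.
have X0 := rayX_ge0 t2 al hc; have Y0 := rayY_ge0 t2 al hc.
have h1 : 3 * cos x <= t * sin x by apply: sin_ge_cos_ray => //; lra.
have := ray_le t2 al cs; move: X0 Y0; move: (rayX _ _ _) (rayY _ _ _).
move=> X Y X0 Y0 hXY.
have e1 : cos x * (t * (`|s| * Y)) <= cos x * (3 * X) by rewrite ler_wpM2l.
have e2 : (3 * cos x) * X <= (t * sin x) * X by rewrite ler_wpM2r.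
have e3 : cos x * (`|s| * Y) <= sin x * X.
  by rewrite -(ler_pM2l (_ : 0 < t)); lra.
have e4 : cos x * (- s * Y) <= cos x * (`|s| * Y).
  by rewrite ler_wpM2l // ler_wpM2r // -normrN ler_norm.
lra.
Qed.

Lemma ray_pos_ge0 t a x : 2 <= t -> 3 <= (2 * t + 1) * a <= 51 / 10 ->
  0 <= x <= pi / 2 ->
  0 <= (3 * t + 1) * sin x + (2 * t + 1) * a * sin ((t + 1) * x)
       + (t + 1) * a * sin ((2 * t + 1) * x) + sin ((3 * t + 1) * x).
Proof.
move=> t2 al /[dup] hx /andP[x0 x1]; have pi3 := pi_ge3 R.
have [-> -> ->] := sin_multiples t x.
suff : 0 <= sin x * rayX t a (cos (t * x))
          + cos x * sin (t * x) * rayY t a (cos (t * x)).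
  by congr (_ <= _); rewrite /rayX /rayY; ring.
have [h|/ltW h] := leP (t * x) pi; last exact: ray_dominated (cos2Dsin2 _).
have tx0 : 0 <= t * x by rewrite mulr_ge0 //; lra.
apply: addr_ge0; apply: mulr_ge0.
- by apply: sin_ge0_pi; lra.
- exact: rayX_ge0.
- apply: mulr_ge0; first by apply: cos_ge0_pihalf; lra.
  by apply: sin_ge0_pi; rewrite tx0.
- exact: rayY_ge0.
Qed.

(** Negating both [cos (t x)] and [sin (t x)] turns the value at 1 into the value at -1. *)
Lemma ray_neg_ge0_far t a x : 2 <= t -> 3 <= (2 * t + 1) * a <= 51 / 10 ->
  0 <= x <= pi / 2 -> pi <= t * x ->
  0 <= (3 * t + 1) * sin x - (2 * t + 1) * a * sin ((t + 1) * x)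
       + (t + 1) * a * sin ((2 * t + 1) * x) - sin ((3 * t + 1) * x).
Proof.
move=> t2 al hx h; have [-> -> ->] := sin_multiples t x.
have : 0 <= sin x * rayX t a (- cos (t * x))
          + cos x * - sin (t * x) * rayY t a (- cos (t * x)).
  by apply: ray_dominated => //; rewrite !sqrrN cos2Dsin2.
by congr (_ <= _); rewrite /rayX /rayY; ring.
Qed.

(** For [t x >= pi], [(3 t + 1) sin x >= 5] makes the first square dominate. Otherwise the minor is
    a quadratic form in [sin x] and [cos x sin (t x)], nonnegative on a cone containing this
    pair. *)
Lemma schur_ge0 t a x : 2 <= t -> 3 <= (2 * t + 1) * a <= 51 / 10 ->
  0 <= x <= pi / 2 ->
  0 <= ((3 * t + 1) * sin x) ^+ 2 - sin ((3 * t + 1) * x) ^+ 2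
       - (3 * t + 1) * sin x * ((t + 1) * a * sin ((2 * t + 1) * x))
       + sin ((3 * t + 1) * x) * ((2 * t + 1) * a * sin ((t + 1) * x)).
Proof.
move=> t2 al /[dup] hx /andP[x0 x1]; have pi3 := pi_ge3 R.
have s0 : 0 <= sin x by apply: sin_ge0_pi; lra.
have k0 : 0 <= cos x by apply: cos_ge0_pihalf; lra.
have [h|/ltW h] := leP (t * x) pi; last first.
  have h1 : 3 * cos x <= t * sin x by apply: sin_ge_cos_ray => //; lra.
  have a0 : 0 <= a by case/andP: al; nra.
  have ml : (t + 1) * a <= 31 / 10 by case/andP: al; nra.
  (* From [3 cos x <= t sin x] comes [sin^2 x >= 9 / (t^2 + 9)], and
     [9 (3 t + 1)^2 / (t^2 + 9) >= 25] for [t >= 2]. *)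
  have sx : 25 <= ((3 * t + 1) * sin x) ^+ 2.
    have : (3 * cos x) ^+ 2 <= (t * sin x) ^+ 2.
      by rewrite ler_sqr // ?nnegrE; [lra|rewrite mulr_ge0 //; lra].
    rewrite exprMn (cos2sin2 x) => h2.
    have h3 : 9 / (t ^+ 2 + 9) <= sin x ^+ 2.
      by rewrite ler_pdivrMr; [lra|have := sqr_ge0 t; lra].
    rewrite exprMn; apply: le_trans (_ : (3 * t + 1) ^+ 2 * (9 / (t ^+ 2 + 9)) <= _).
      by rewrite mulrA ler_pdivlMr; [nra|have := sqr_ge0 t; lra].
    by rewrite ler_wpM2l // sqr_ge0.
  have n0 : 0 <= (3 * t + 1) * sin x by rewrite mulr_ge0 //; lra.
  have X5 : 5 <= (3 * t + 1) * sin x by nra.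
  move: (_ * sin x) n0 X5 sx => X n0 X5 _.
  have S4 := sin_max ((3 * t + 1) * x); have S3 := sin_max ((2 * t + 1) * x).
  have S2 := sin_max ((t + 1) * x).
  move: (sin _) S4 (sin _) S3 (sin _) S2 => s4 S4 s3 S3 s2 S2.
  have e1 : s4 ^+ 2 <= 1 by rewrite -real_normK ?num_real // expr_le1.
  have e2 : s3 * ((t + 1) * a) <= 31 / 10.
    apply: le_trans (_ : `|s3| * (31 / 10) <= _); last by lra.
    apply: le_trans (_ : `|s3| * ((t + 1) * a) <= _).
      by rewrite ler_wpM2r ?ler_norm // mulr_ge0 //; lra.
    by rewrite ler_wpM2l.
  have e3 : - (s4 * s2) * ((2 * t + 1) * a) <= 51 / 10.
    apply: le_trans (_ : `|- (s4 * s2)| * ((2 * t + 1) * a) <= _).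
      by rewrite ler_wpM2r ?ler_norm // mulr_ge0 //; lra.
    apply: le_trans (_ : 1 * ((2 * t + 1) * a) <= _); last by lra.
    rewrite ler_wpM2r // ?mulr_ge0 //; first by lra.
    by rewrite normrN normrM mulr_ile1.
  have e4 : X * (s3 * ((t + 1) * a)) <= X * (31 / 10) by rewrite ler_wpM2l.
  have : 25 <= X ^+ 2 by nra.
  have : 5 * X <= X ^+ 2 by nra.
  lra.
have tx0 : 0 <= t * x by rewrite mulr_ge0 //; lra.
have [-> -> ->] := sin_multiples t x.
have ss0 : 0 <= sin (t * x) by apply: sin_ge0_pi; rewrite tx0.
have q0 : 0 < t * (2 + cos (t * x)).
  by rewrite mulr_gt0; have := cos_geN1 (t * x); lra.
(* The cone condition: [t x (2 + cos (t x)) >= 3 sin (t x)] times [cos x], combined with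
   [sin x >= x cos x]. *)
have eta0 : 0 <= t * (2 + cos (t * x)) * sin x - 3 * (cos x * sin (t * x)).
  have : 3 * sin (t * x) <= t * x * (2 + cos (t * x)).
    by apply: sin_le_cusa; rewrite tx0.
  have : x * cos x <= sin x by apply: mul_cos_le_sin; lra.
  move=> /(ler_wpM2l (ltW q0)) i1 /(ler_wpM2l k0) i2; lra.
have y0 : 0 <= cos x * sin (t * x) by rewrite mulr_ge0.
have c_itv := cos_itv (t * x).
have hA := schurA_ge0 t2 al c_itv; have hB := schurAB_ge0 t2 al c_itv.
have hC := schurABC_ge0 t2 al c_itv.
move: (cos (t * x)) (sin (t * x)) (sin x) (cos x) q0 eta0 y0 hA hB hC
  => c s sx cx q0 eta0 y0 hA hB hC.
have q2 : 0 < (t * (2 + c)) ^+ 2 by rewrite exprn_gt0.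
rewrite -(pmulr_rge0 _ q2).
have := addr_ge0 (addr_ge0 (mulr_ge0 hA (sqr_ge0 (t * (2 + c) * sx - 3 * (cx * s))))
  (mulr_ge0 hB (mulr_ge0 eta0 y0))) (mulr_ge0 hC (sqr_ge0 (cx * s))).
by congr (_ <= _); rewrite /schurA /schurB /schurC; ring.
Qed.

End rays.

(** * The value at -1 for small angles, and the case T = 1 *)

Section near_ray.
Variable R : realType.
Implicit Types t x y : R.

Definition ray_neg t a x : R :=
  (3 * t + 1) * sin x - (2 * t + 1) * a * sin ((t + 1) * x)
  + (t + 1) * a * sin ((2 * t + 1) * x) - sin ((3 * t + 1) * x).

Let slope t a y := (3 * t + 1) * (2 * cos (t * y) + 1) - (2 * t + 1) * (t + 1) * a.

(** The frequencies [1, t + 1, 2 t + 1, 3 t + 1] are symmetric about [(3 t + 2) / 2]. Pairing the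
    cosines of the derivative extracts [sin u], and [sin (3 v) = sin v (2 cos (2 v) + 1)] extracts
    [sin v]. *)
Let is_derive_ray_neg t a y : is_derive y 1 (ray_neg t a)
  (2 * sin ((3 * t + 2) * y / 2) * sin (t * y / 2) * slope t a y).
Proof.
apply: (is_derive_eq (is_derive1B (is_derive1D (is_derive1B
  (is_derive1Z (is_derive_sin y) (3 * t + 1))
  (is_derive1Z (is_derive_sinZ (t + 1) y) ((2 * t + 1) * a)))
  (is_derive1Z (is_derive_sinZ (2 * t + 1) y) ((t + 1) * a)))
  (is_derive_sinZ (3 * t + 1) y))).
set u := (3 * t + 2) * y / 2; set v := t * y / 2.
have -> : (t + 1) * y = u - v by rewrite /u /v; field.
have -> : (2 * t + 1) * y = u + v by rewrite /u /v; field.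
have -> : (3 * t + 1) * y = u + (v + v + v) by rewrite /u /v; field.
rewrite /slope; have -> : t * y = v + v by rewrite /v; field.
have {1}-> : y = u - (v + v + v) by rewrite /u /v; field.
rewrite !(sinB, cosB, sinD, cosD).
have := sin2cos2 v; move: (sin v) (cos v) => s c s2.
apply: etrans (_ : 2 * sin u * s * ((3 * t + 1) * (3 * c ^+ 2 - s ^+ 2)
  - (2 * t + 1) * (t + 1) * a) = _); first by ring.
have -> : c * c - s * s = 2 * c ^+ 2 - 1 by rewrite -!expr2 s2; ring.
by rewrite s2; ring.
Qed.

Let derive_le0_ge (f df : R -> R) (a b : R) : a <= b ->
  (forall x, is_derive x 1 f (df x)) ->
  (forall x, a <= x <= b -> df x <= 0) -> f b <= f a.
Proof.
move=> ab fdf df0; rewrite -lerN2.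
have dN x : is_derive x 1 (fun y => - f y) (- df x) by exact: is_deriveN.
by apply: derive_ge0_le ab dN _ => x /df0; rewrite oppr_ge0.
Qed.

(* [ray_neg] vanishes at 0 and at [2 pi / (3 t + 2)]: it increases and then
   decreases between these two points, and increases again after the second. *)
Lemma ray_neg_ge0_near t x : 1 <= t -> 0 <= x -> t * x <= pi ->
  (3 * t + 2) * x <= 4 * pi -> 0 <= ray_neg t (suffridge_a t) x.
Proof.
move=> t1 x0 tx nx; have pi3 := pi_ge3 R.
set a := suffridge_a t.
have a0 : 0 <= a.
  have /andP[] := suffridge_a_bounds t1; rewrite -/a => h _.
  by rewrite -(pmulr_rge0 _ (_ : 0 < 2 * t + 1)); lra.
pose z : R := 2 * pi / (3 * t + 2).
have zE : (3 * t + 2) * z = 2 * pi by rewrite mulrC divfK // gt_eqF //; lra.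
have z0 : 0 < z by rewrite divr_gt0; lra.
have tz : t * z <= pi by lra.
have aE : a = 1 + 2 * cos (t * z).
  by rewrite /a /suffridge_a /z; congr (1 + 2 * cos _); ring.
have slope_anti y y' : 0 <= y -> y <= y' -> t * y' <= pi ->
    slope t a y' <= slope t a y.
  move=> y0 yy' hy'; rewrite lerD2r ler_pM2l; last by lra.
  rewrite lerD2r ler_pM2l //.
  have [->//|ne] := eqVneq y y'.
  rewrite ltW // ltr_cos ?in_itv /=.
  - by rewrite ltr_pM2l; [rewrite lt_neqAle ne|lra].
  - rewrite mulr_ge0 //=; last by lra.
    by apply: le_trans hy'; rewrite ler_pM2l //; lra.
  - by rewrite mulr_ge0 //; lra.
have ray0 : ray_neg t a 0 = 0 by rewrite /ray_neg !mulr0 sin0; ring.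
(* As [(3 t + 2) z = 2 pi], the sines cancel in pairs up to [sin z = a sin ((t + 1) z)], which the
   choice of [a] ensures. *)
have rayz : ray_neg t a z = 0.
  have e3 : sin ((3 * t + 1) * z) = - sin z.
    have -> : (3 * t + 1) * z = - z + pi *+ 2 by rewrite mulr2n; lra.
    by rewrite sinD2pi sinN.
  have e2 : sin ((2 * t + 1) * z) = - sin ((t + 1) * z).
    have -> : (2 * t + 1) * z = - ((t + 1) * z) + pi *+ 2 by rewrite mulr2n; lra.
    by rewrite sinD2pi sinN.
  have e1 : sin ((2 * t + 1) * z) + sin z = 2 * cos (t * z) * sin ((t + 1) * z).
    have -> : (2 * t + 1) * z = (t + 1) * z + t * z by ring.
    have -> : sin z = sin ((t + 1) * z - t * z) by congr sin; ring.
    by rewrite sinD sinB; ring.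
  have {}e1 : sin z = a * sin ((t + 1) * z) by rewrite aE; lra.
  by rewrite /ray_neg e3 e2 e1; ring.
have sin_v y : 0 <= y -> t * y <= pi -> 0 <= sin (t * y / 2).
  move=> y0 ty; apply: sin_ge0_pi.
  by have : 0 <= t * y by [rewrite mulr_ge0 //; lra]; lra.
have sin_u y : 0 <= y -> y <= z -> 0 <= sin ((3 * t + 2) * y / 2).
  move=> y0 yz; apply: sin_ge0_pi.
  have : (3 * t + 2) * y <= (3 * t + 2) * z by rewrite ler_pM2l //; lra.
  by have : 0 <= (3 * t + 2) * y by [rewrite mulr_ge0 //; lra]; lra.
have le_t y : y <= x -> t * y <= pi.
  by move=> yx; apply: le_trans tx; rewrite ler_pM2l //; lra.
have [xz|/ltW zx] := leP x z.
  (* The slope factor is nonincreasing: if nonnegative at [x], the function climbs from its zero at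
     0 to [x]; if negative, it descends from [x] to its zero at [z]. *)
  have [g0|g0] := leP 0 (slope t a x).
    rewrite -ray0; apply: derive_ge0_le (is_derive_ray_neg t a) _ => // y /andP[y0 yx].
    rewrite mulr_ge0 //; last by apply: le_trans g0 (slope_anti _ _ _ _ _).
    by rewrite mulr_ge0 ?sin_v ?le_t // mulr_ge0 // sin_u // (le_trans yx).
  rewrite -rayz; apply: derive_le0_ge (is_derive_ray_neg t a) _ => // y /andP[xy yz].
  have y0 : 0 <= y by apply: le_trans xy.
  have ty : t * y <= pi by apply: le_trans tz; rewrite ler_pM2l //; lra.
  rewrite mulr_ge0_le0 //; last by apply: le_trans (ltW g0); exact: slope_anti.
  by rewrite mulr_ge0 ?sin_v // mulr_ge0 // sin_u.
rewrite -rayz; apply: derive_ge0_le (is_derive_ray_neg t a) _ => // y /andP[zy yx].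
have y0 : 0 <= y by apply: le_trans zy; exact: ltW.
rewrite mulr_le0 //.
  rewrite mulr_le0_ge0 ?sin_v ?le_t // mulr_ge0_le0 //.
  have -> : (3 * t + 2) * y / 2 = ((3 * t + 2) * y / 2 - pi) + pi by rewrite subrK.
  rewrite sinDpi oppr_le0; apply: sin_ge0_pi.
  have : (3 * t + 2) * z <= (3 * t + 2) * y by rewrite ler_pM2l //; lra.
  have : (3 * t + 2) * y <= (3 * t + 2) * x by rewrite ler_pM2l //; lra.
  lra.
apply: le_trans (slope_anti _ _ (ltW z0) zy (le_t _ yx)) _.
(* The slope factor at [z] is [- 2 t^2 a], so it stays nonpositive beyond [z], as does
   [sin ((3 t + 2) y / 2)]. *)
rewrite /slope; have -> : 2 * cos (t * z) + 1 = a by rewrite aE; ring.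
have : 0 <= (2 * t ^+ 2) * a by rewrite mulr_ge0 // mulr_ge0 // sqr_ge0.
lra.
Qed.

(** Induction with the addition formula gives the weak inequality; [cos x < 1] makes its last step
    strict. *)
Lemma normr_sin_mulr_lt (n : nat) x : (1 < n)%N -> 0 < x <= pi / 2 ->
  `|sin (n%:R * x)| < n%:R * sin x.
Proof.
case: n => [|[|n]] // _ /andP[x0 x1]; have pi0 := pi_gt0 R.
have s0 : 0 < sin x by apply: sin_gt0_pi; lra.
have k0 : 0 <= cos x by apply: cos_ge0_pihalf; lra.
have k1 : cos x < 1 by rewrite -[1]cos0 ltr_cos ?in_itv /=; lra.
have le_sin (m : nat) : `|sin (m%:R * x)| <= m%:R * sin x.
  elim: m => [|m IHm]; first by rewrite !mul0r sin0 normr0.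
  rewrite -natr1 !mulrDl !mul1r sinD (le_trans (ler_normD _ _)) // !normrM.
  apply: lerD; first by rewrite (le_trans (ler_piMr _ (cos_max _))).
  by rewrite (gtr0_norm s0) ler_piMl ?cos_max // ltW.
rewrite -natr1 !mulrDl !mul1r sinD (le_lt_trans (ler_normD _ _)) // !normrM.
apply: ltr_leD; last by rewrite (gtr0_norm s0) ler_piMl ?cos_max // ltW.
apply: le_lt_trans (_ : n.+1%:R * sin x * cos x < _).
  by rewrite (ger0_norm k0) ler_wpM2r.
by rewrite gtr_pMr // mulr_gt0.
Qed.

(** The polynomial bounds above assume [T >= 2]. At [T = 1], [sin x] factors out and leaves a
    polynomial in [cos x] with nonnegative coefficients. *)
Lemma ray_pos1_ge0 a x : 1 <= a <= 17 / 10 -> 0 <= x <= pi / 2 ->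
  0 <= (3 * 1 + 1) * sin x + (2 * 1 + 1) * a * sin ((1 + 1) * x)
       + (1 + 1) * a * sin ((2 * 1 + 1) * x) + sin ((3 * 1 + 1) * x).
Proof.
move=> ha /andP[x0 x1]; have pi0 := pi_gt0 R.
have [-> -> ->] := sin_multiples 1 x; rewrite !mul1r.
have s0 : 0 <= sin x by apply: sin_ge0_pi; lra.
have k0 : 0 <= cos x by apply: cos_ge0_pihalf; lra.
have : 0 <= sin x * (4 - 2 * a + (6 * a - 4) * cos x + 8 * a * cos x ^+ 2
                     + 8 * cos x ^+ 3).
  apply: mulr_ge0 => //.
  have : 0 <= (6 * a - 4) * cos x by rewrite mulr_ge0 //; lra.
  have : 0 <= a * cos x ^+ 2 by rewrite mulr_ge0 ?sqr_ge0 //; lra.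
  by have := exprn_ge0 3 k0; lra.
by congr (_ <= _); ring.
Qed.

Lemma schur1_ge0 a x : 1 <= a <= 17 / 10 ->
  0 <= ((3 * 1 + 1) * sin x) ^+ 2 - sin ((3 * 1 + 1) * x) ^+ 2
       - (3 * 1 + 1) * sin x * ((1 + 1) * a * sin ((2 * 1 + 1) * x))
       + sin ((3 * 1 + 1) * x) * ((2 * 1 + 1) * a * sin ((1 + 1) * x)).
Proof.
move=> ha; have [-> -> ->] := sin_multiples 1 x; rewrite !mul1r.
(* The factored minor; as a quadratic in [cos^2 x], its last factor has minimum
   [2 + a - 9 a^2 / 8]. *)
have h : 0 <= 8 * sin x ^+ 4 * (8 * (cos x ^+ 2) ^+ 2 - 6 * a * cos x ^+ 2 + 2 + a).
  apply: mulr_ge0; first by rewrite mulr_ge0 // exprn_even_ge0.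
  by have := sqr_ge0 (cos x ^+ 2 - 3 / 8 * a); nra.
move: h; congr (_ <= _); have := cos2sin2 x; move: (cos x) (sin x) => c s c2.
rewrite [s ^+ 4](_ : _ = s ^+ 2 * (1 - c ^+ 2)); last by rewrite c2; ring.
by ring.
Qed.

End near_ray.

(** * Nonvanishing of the chord cubic *)

Section chord.
Variable R : realType.
Implicit Types (T : nat) (x : R) (w : R[i]).

(* Up to a nonzero factor, the difference of the values of the polynomial at
   [v e^(i x)] and [v e^(- i x)], where [w = v^T]. *)
Definition chord_cubic T x w : R[i] :=
  let t := T%:R in let a := suffridge_a t in
  ((3 * t + 1) * sin x)%:C + ((2 * t + 1) * a * sin ((t + 1) * x))%:C * w
  + ((t + 1) * a * sin ((2 * t + 1) * x))%:C * w ^+ 2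
  + (sin ((3 * t + 1) * x))%:C * w ^+ 3.

Let chord_cubic_neq0_half T x w : (0 < T)%N -> 0 < x <= pi / 2 -> `|w| < 1 ->
  chord_cubic T x w != 0.
Proof.
move=> T0 /[dup] hx /andP[x0 x1] w1; have pi3 := pi_ge3 R.
have hx' : 0 <= x <= pi / 2 by rewrite ltW.
have t1 : 1 <= T%:R :> R by rewrite ler1n.
have hl := suffridge_a_bounds t1.
have t_cases : T%:R = 1 :> R \/ 2 <= T%:R :> R.
  by case: T T0 {t1 hl} => [|[|T]] // _; [left|right; rewrite (ler_nat _ 2)].
apply: real_cubic_neq0 => //.
- have := @normr_sin_mulr_lt R (3 * T + 1) x.
  by rewrite natrD natrM; apply => //; rewrite addn1 ltnS muln_gt0.
- case: t_cases => [tE|t2]; last exact: ray_pos_ge0.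
  by move: hl; rewrite tE => hl; apply: ray_pos1_ge0 => //; lra.
- have [h|/ltW h] := leP (T%:R * x) pi.
    apply: ray_neg_ge0_near => //; first exact: ltW.
    by case: t_cases => [tE|t2]; [rewrite tE|]; nra.
  case: t_cases => [tE|t2]; last exact: ray_neg_ge0_far.
  by move: h; rewrite tE; lra.
- case: t_cases => [tE|t2]; last exact: schur_ge0.
  by move: hl; rewrite tE => hl; apply: schur1_ge0 => //; lra.
Qed.

Let sin_natpiB (m : nat) x : sin (m.+1%:R * pi - x) = (-1) ^+ m * sin x.
Proof.
rewrite mulr_natl addrC (alternatingn (@sinDpi R)) sinN exprS.
by rewrite mulrN !mulN1r mulNr opprK.
Qed.

(** Replacing [x] by [pi - x] multiplies [sin ((k T + 1) x)] by [(-1)^(k T)], which the change of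
    [w] to [(-1)^T w] undoes. *)
Lemma chord_cubic_neq0 T x w : (0 < T)%N -> 0 < x < pi -> `|w| < 1 ->
  chord_cubic T x w != 0.
Proof.
move=> T0 /andP[x0 x1] w1; have [h|h] := leP x (pi / 2).
  by apply: chord_cubic_neq0_half => //; rewrite x0.
pose e : R := (-1) ^+ T.
have <- : chord_cubic T (pi - x) (e%:C * w) = chord_cubic T x w.
  have sinE k : sin ((k%:R * T%:R + 1) * (pi - x))
      = e ^+ k * sin ((k%:R * T%:R + 1) * x).
    by rewrite -natrM natr1 mulrBr sin_natpiB mulnC exprM.
  rewrite /chord_cubic (sinE 2%N) (sinE 3%N).
  have := sinE 1%N; rewrite !mul1r => ->.
  have -> : sin (pi - x) = sin x by rewrite -[pi]mul1r (sin_natpiB 0) mul1r.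
  have [->|->] : e = 1 \/ e = -1.
    by rewrite /e -signr_odd; case: (odd T); [right|left].
  - by rewrite !expr1n !mul1r.
  - by rewrite !rmorphM !rmorphXn !rmorphN1; ring.
apply: chord_cubic_neq0_half => //; first by lra.
by rewrite normrM /e rmorphXn rmorphN1 normrX normrN1 expr1n mul1r.
Qed.

End chord.

(** * Reduction to chords of circles *)

Section disk_reduction.
Variable R : realType.
Implicit Types (p : {poly R[i]}) (z : R[i]).

(** A polynomial in both points, hence defined on the diagonal too. The inner sum is empty for
    [k = 0], so [k.-1] never truncates. *)
Definition divided_difference p z1 z2 : R[i] :=
  \sum_(k < size p) p`_k * \sum_(i < k) z1 ^+ (k.-1 - i) * z2 ^+ i.

Lemma divided_differenceE p z1 z2 :
  p.[z1] - p.[z2] = (z1 - z2) * divided_difference p z1 z2.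
Proof.
rewrite !horner_coef -sumrB mulr_sumr; apply: eq_bigr => k _.
by rewrite -mulrBr subrXX mulrCA.
Qed.

Lemma divided_difference_diag p z : divided_difference p z z = p^`().[z].
Proof.
rewrite -[in RHS](coefK p) poly_def raddf_sum horner_sum; apply: eq_bigr => k _.
rewrite /= derivZ derivXn hornerZ hornerMn hornerXn; congr (_ * _).
rewrite (eq_bigr (fun=> z ^+ k.-1)) ?sumr_const ?card_ord // => i _.
by rewrite -exprD subnK // -ltnS (leq_trans (ltn_ord i)) // leqSpred.
Qed.

Lemma divided_difference_bound p z1 z2 : `|z1| <= 1 -> `|z2| <= 1 ->
  `|divided_difference p z1 z2| <= \sum_(k < size p) `|p`_k| * k%:R.
Proof.
move=> h1 h2; apply: le_trans (ler_norm_sum _ _ _) _; apply: ler_sum => k _.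
rewrite normrM ler_wpM2l // (le_trans (ler_norm_sum _ _ _)) //.
have -> : k%:R = \sum_(i < k) 1 :> R[i] by rewrite sumr_const card_ord.
apply: ler_sum => i _.
by rewrite normrM !normrX mulr_ile1 ?exprn_ge0 ?exprn_ile1.
Qed.

(** If all roots of [p - v] were at distance at least [e] from [z], factoring would give
    [|p(z) - v| >= |lead_coef p| e^deg p]. *)
Lemma horner_open p z (e : R[i]) : (1 < size p)%N -> 0 < e ->
  exists2 d : R[i], 0 < d &
    forall v, `|p.[z] - v| < d -> exists2 u, p.[u] = v & `|u - z| < e.
Proof.
move=> p1 e0; exists (`|lead_coef p| * e ^+ (size p).-1).
  rewrite mulr_gt0 ?exprn_gt0 // normr_gt0 lead_coef_eq0.
  by apply: contraTneq p1 => ->; rewrite size_poly0.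
move=> v hv; pose q := p - v%:P.
have sq : size q = size p.
  by rewrite /q size_polyDl // size_polyN (leq_ltn_trans (size_polyC_leq1 v)).
have lq : lead_coef q = lead_coef p.
  by rewrite /q lead_coefDl // size_polyN (leq_ltn_trans (size_polyC_leq1 v)).
have [r qE] := closed_field_poly_normal q.
have lq0 : lead_coef q != 0.
  by rewrite lead_coef_eq0 -size_poly_eq0 sq; case: (size p) p1.
have sr : size r = (size p).-1.
  by rewrite -sq qE size_scale // size_prod_XsubC.
have [/hasP[u ur hu]|/hasPn h] := boolP (has (fun u => `|u - z| < e) r).
  exists u => //; apply/eqP; rewrite -subr_eq0; apply/eqP.
  have -> : p.[u] - v = q.[u] by rewrite /q hornerD hornerN hornerC.
  apply/rootP; rewrite qE rootZ // root_prod_XsubC //.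
have hqz : p.[z] - v = q.[z] by rewrite /q hornerD hornerN hornerC.
move: hv; rewrite hqz qE hornerZ horner_prod normrM normr_prod lq -sr.
rewrite ltr_pM2l; last by rewrite normr_gt0 -lq.
suff -> : forall s : seq R[i], (forall u, u \in s -> ~~ (`|u - z| < e)) ->
   (\prod_(i <- s) `|('X - i%:P).[z]| < e ^+ size s) = false by [].
elim=> [|u s IHs] hs; first by rewrite big_nil expr0 ltxx.
have hu : e <= `|('X - u%:P).[z]|.
  rewrite hornerXsubC distrC real_leNgt ?normr_real ?hs ?mem_head //.
  exact: gtr0_real.
rewrite big_cons /= exprS; apply/negP => hlt.
have /negP : ~~ (\prod_(i <- s) `|('X - i%:P).[z]| < e ^+ size s).
  by rewrite IHs // => y ys; apply: hs; rewrite in_cons ys orbT.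
apply; rewrite -(ltr_pM2l e0); apply: le_lt_trans hlt.
by rewrite ler_wpM2r // prodr_ge0.
Qed.

(** Pull [z2] slightly inwards to [u2]; by openness some [u1] near [z1] has the same value, and it
    is still shorter than [z2]. *)
Lemma shrink_collision p z1 z2 : (1 < size p)%N -> `|z1| < `|z2| -> `|z2| <= 1 ->
  p.[z1] = p.[z2] ->
  exists u1 u2, [/\ u1 != u2, `|u1| < `|z2|, `|u2| < `|z2| & p.[u1] = p.[u2]].
Proof.
move=> p1 z12 z2_le1 pz; pose d := (`|z2| - `|z1|) / 2.
have d0 : 0 < d by rewrite divr_gt0 ?subr_gt0.
have z2_gt0 : 0 < `|z2| by apply: le_lt_trans z12.
have [e e0 he] := @horner_open p z1 d p1 d0.
pose M := \sum_(k < size p) `|p`_k| * k%:R.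
have M0 : 0 < 1 + M.
  by rewrite ltr_wpDr // sumr_ge0 // => k _; rewrite mulr_ge0.
pose h := e / (1 + M); have h0 : 0 < h by rewrite divr_gt0.
(* The order on [R[i]] is partial, so [y] below both [h] and [d] is built as a product of two
   numbers below 1, each under one of the bounds. *)
have small (x : R[i]) : 0 < x -> exists y : R[i], [/\ 0 < y, y < x & y < 1].
  move=> x0; have x10 : 0 < 1 + x by rewrite addr_gt0.
  exists (x / (1 + x)); split; first by rewrite divr_gt0.
    by rewrite ltr_pdivrMr // mulrDr mulr1 ltrDl mulr_gt0.
  by rewrite ltr_pdivrMr // mul1r ltrDr.
have [h' [h'0 h'h h'1]] := small _ h0; have [d' [d'0 d'd d'1]] := small _ d0.
pose y := h' * d'.
have y0 : 0 < y by rewrite mulr_gt0.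
have yh : y < h by apply: lt_trans h'h; rewrite gtr_pMr.
have yd : y < d by apply: lt_trans d'd; rewrite gtr_pMl.
have y1 : y < 1 by apply: lt_trans h'1; rewrite gtr_pMr.
pose u2 := (1 - y) * z2.
have zu2 : z2 - u2 = y * z2 by rewrite /u2 mulrBl mul1r opprB addrC subrK.
have nzu2 : `|z2 - u2| <= y by rewrite zu2 normrM gtr0_norm // ler_piMr // ltW.
have [|u1 pu1 u1z1] := he p.[u2].
  rewrite pz divided_differenceE normrM.
  have u2_le1 : `|u2| <= 1.
    rewrite normrM mulr_ile1 // ger0_norm ?subr_ge0 ?(ltW y1) //.
    by rewrite gerBl ltW.
  apply: le_lt_trans (_ : y * (1 + M) < _).
    apply: ler_pM => //.
    apply: le_trans (divided_difference_bound _ z2_le1 u2_le1) _.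
    by rewrite lerDr.
  by rewrite -ltr_pdivlMr.
have hd : d + d = `|z2| - `|z1| by rewrite /d -splitr.
exists u1, u2; split => //.
- apply/eqP => u12; have : `|z2 - z1| < d + d.
    rewrite -(subrK u2 z2) -addrA (le_lt_trans (ler_normD _ _)) // ler_ltD //.
      by rewrite (le_trans nzu2) // ltW.
    by rewrite -u12.
  by rewrite hd => /lt_le_trans/(_ (lerB_dist _ _)); rewrite ltxx.
- rewrite -(subrK z1 u1) (le_lt_trans (ler_normD _ _)) //.
  apply: lt_trans (_ : d + `|z1| < _); first by rewrite ltrD2r.
  by rewrite -ltrBrDr -hd ltrDl.
- rewrite normrM gtr_pMl // ger0_norm ?subr_ge0 ?ltW //.
  by rewrite gtrBl.
Qed.

(** Compactness is applied in real coordinates, and moduli are compared through a real-valued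
    square. *)
Let plane (x : R * R) : R[i] := x.1 +i* x.2.

Let sqmod (x : R * R) : R := x.1 ^+ 2 + x.2 ^+ 2.

(** * Continuity through real and imaginary parts *)

Section complex_valued_continuity.
Variable E : topologicalType.
Implicit Types f g : E -> R[i].

Let ccontinuous f :=
  continuous (fun x => complex.Re (f x)) /\
  continuous (fun x => complex.Im (f x)).

Let ccontinuous_cst z : ccontinuous (fun=> z).
Proof. by split => x; exact: cst_continuous. Qed.

Let ccontinuousD f g : ccontinuous f -> ccontinuous g ->
  ccontinuous (fun x => f x + g x).
Proof.
move=> [fr fi] [gr gi]; split.
  have -> : (fun x => complex.Re (f x + g x)) =
      (fun x => complex.Re (f x) + complex.Re (g x)).
    by apply/funext => x; case: (f x) => ? ?; case: (g x).
  by move=> x; apply: cvgD; [exact: fr|exact: gr].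
have -> : (fun x => complex.Im (f x + g x)) =
    (fun x => complex.Im (f x) + complex.Im (g x)).
  by apply/funext => x; case: (f x) => ? ?; case: (g x).
by move=> x; apply: cvgD; [exact: fi|exact: gi].
Qed.

Let ccontinuousM f g : ccontinuous f -> ccontinuous g ->
  ccontinuous (fun x => f x * g x).
Proof.
move=> [fr fi] [gr gi]; split.
  have -> : (fun x => complex.Re (f x * g x)) =
      (fun x => complex.Re (f x) * complex.Re (g x)
                - complex.Im (f x) * complex.Im (g x)).
    by apply/funext => x; case: (f x) => ? ?; case: (g x).
  move=> x; apply: cvgB.
    by apply: cvgM; [exact: fr|exact: gr].
  by apply: cvgM; [exact: fi|exact: gi].
have -> : (fun x => complex.Im (f x * g x)) =
    (fun x => complex.Re (f x) * complex.Im (g x)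
              + complex.Im (f x) * complex.Re (g x)).
  by apply/funext => x; case: (f x) => ? ?; case: (g x).
move=> x; apply: cvgD.
  by apply: cvgM; [exact: fr|exact: gi].
by apply: cvgM; [exact: fi|exact: gr].
Qed.

Let ccontinuousX f n : ccontinuous f -> ccontinuous (fun x => f x ^+ n).
Proof.
move=> cf; elim: n => [|n IHn]; first exact: ccontinuous_cst.
by under eq_fun do rewrite exprS; exact: ccontinuousM.
Qed.

Let ccontinuous_sum (I : Type) (r : seq I) (F : I -> E -> R[i]) :
  (forall i, ccontinuous (F i)) -> ccontinuous (fun x => \sum_(i <- r) F i x).
Proof.
move=> cF; elim: r => [|i r IHr].
  by under eq_fun do rewrite big_nil; exact: ccontinuous_cst.
by under eq_fun do rewrite big_cons; exact: ccontinuousD.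
Qed.

Lemma continuous_divided_difference p (f g : E -> R * R) :
  continuous f -> continuous g ->
  let h x := divided_difference p (plane (f x)) (plane (g x)) in
  continuous (fun x => complex.Re (h x)) /\ continuous (fun x => complex.Im (h x)).
Proof.
move=> cf cg.
have cplane (u : E -> R * R) : continuous u -> ccontinuous (fun x => plane (u x)).
  move=> cu; split => x /=.
    by apply: (continuous_comp (cu x)); exact: cvg_fst.
  by apply: (continuous_comp (cu x)); exact: cvg_snd.
apply: ccontinuous_sum => k; apply: ccontinuousM; first exact: ccontinuous_cst.
by apply: ccontinuous_sum => i; apply: ccontinuousM; exact: ccontinuousX (cplane _ _).
Qed.

Lemma continuous_sqmod (f : E -> R * R) :
  continuous f -> continuous (fun x => sqmod (f x)).
Proof.
move=> cf x; rewrite /sqmod; under eq_fun do rewrite !expr2.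
have c1 : {for x, continuous (fun x => (f x).1)}.
  by apply: (continuous_comp (cf x)); exact: cvg_fst.
have c2 : {for x, continuous (fun x => (f x).2)}.
  by apply: (continuous_comp (cf x)); exact: cvg_snd.
by apply: cvgD; apply: cvgM.
Qed.

End complex_valued_continuity.

Let norm_plane x y : (`|plane x| < `|plane y|) = (sqmod x < sqmod y).
Proof.
rewrite -(@ltr_pXn2r _ 2) ?nnegrE //.
by rewrite -!add_Re2_Im2 ltcR.
Qed.

Let norm_plane_lt1 x : (`|plane x| < 1) = (sqmod x < 1).
Proof.
rewrite -(@ltr_pXn2r _ 2) ?nnegrE // expr1n.
by rewrite -!add_Re2_Im2 -[1]/(1%:C) ltcR.
Qed.

Lemma univalent_of_circles p : (1 < size p)%N ->
  (forall z1 z2, `|z1| = `|z2| -> `|z2| < 1 -> z1 != z2 -> p.[z1] != p.[z2]) ->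
  (forall z, `|z| < 1 -> p^`().[z] != 0) ->
  univalent_in_unit_disk (fun z => p.[z]).
Proof.
move=> p1 hcirc hder.
pose h (x : (R * R) * (R * R)) := divided_difference p (plane x.1) (plane x.2).
pose M (x : (R * R) * (R * R)) := Num.max (sqmod x.1) (sqmod x.2).
have c1 : continuous (@fst (R * R) (R * R)) by move=> x; exact: cvg_fst.
have c2 : continuous (@snd (R * R) (R * R)) by move=> x; exact: cvg_snd.
have [hr hi] := continuous_divided_difference p c1 c2.
have cM : continuous M.
  move=> x; apply: (@continuous_max _ _ (fun y => sqmod y.1)
    (fun y => sqmod y.2)); exact: continuous_sqmod.
(* The closed square provides compactness; the minimizer still lies in the open disk because the
   given collision does. *)
pose square : set (R * R) := `[-1, 1] `*` `[-1, 1].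
pose K := (square `*` square) `&` [set x | h x = 0].
have K0 x : M x < 1 -> h x = 0 -> K x.
  have sq (y : R * R) : sqmod y < 1 -> square y.
    by rewrite /sqmod /square /= !in_itv /= => ?; split; nra.
  by rewrite gt_max => /andP[/sq ? /sq ?] ?; split => //; split.
have cK : compact K.
  apply: compact_closedI.
    by apply: compact_setX; apply: compact_setX; exact: segment_compact.
  have -> : [set x | h x = 0] =
     (fun x => complex.Re (h x)) @^-1` [set 0] `&`
     (fun x => complex.Im (h x)) @^-1` [set 0].
    apply/seteqP; split => x /=; first by move=> ->.
    by case: (h x) => ? ? [/= -> ->].
  have closed0 : closed [set 0 : R] by exact: closed_eq.
  apply: closedI.
    by apply: preimage_closed closed0 => x _; exact: hr.
  by apply: preimage_closed closed0 => x _; exact: hi.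
move=> [a1 b1] [a2 b2]; rewrite !inE => z1_lt1 z2_lt1 pz; apply/eqP.
apply/negPn/negP => z12.
have : h ((a1, b1), (a2, b2)) = 0.
  apply/eqP; have /eqP := divided_differenceE p (a1 +i* b1) (a2 +i* b2).
  by rewrite pz subrr eq_sym mulf_eq0 subr_eq0 (negPf z12).
have : M ((a1, b1), (a2, b2)) < 1.
  by rewrite gt_max -!norm_plane_lt1 z1_lt1 z2_lt1.
set x := ((a1, b1), (a2, b2)) => Mx hx.
have [c] := compact_EVT_min (ex_intro _ x (K0 _ Mx hx)) cK
  (continuous_subspaceT cM).
move=> /set_mem[_ hc] cmin.
have Mc : M c < 1 by rewrite (le_lt_trans (cmin _ (mem_set (K0 _ Mx hx)))).
have pc : p.[plane c.1] = p.[plane c.2].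
  by apply/eqP; rewrite -subr_eq0 divided_differenceE [divided_difference _ _ _]hc mulr0.
(* Unequal moduli would yield a collision with a smaller maximum modulus than the minimal one. *)
have shrink u v : `|plane u| < `|plane v| -> sqmod v <= M c ->
    p.[plane u] = p.[plane v] -> False.
  move=> uv vc puv.
  have v1 : `|plane v| <= 1 by rewrite ltW // norm_plane_lt1 (le_lt_trans vc).
  have [[x1 y1] [[x2 y2] [u12 h1 h2 pu]]] := shrink_collision p1 uv v1 puv.
  have hM : M ((x1, y1), (x2, y2)) < sqmod v.
    by rewrite gt_max -!norm_plane h1 h2.
  have : M c <= M ((x1, y1), (x2, y2)).
    apply: cmin; apply: mem_set; apply: K0.
      by apply: lt_trans (le_lt_trans vc Mc).
    apply/eqP; have /eqP := divided_differenceE p (x1 +i* y1) (x2 +i* y2).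
    by rewrite pu subrr eq_sym mulf_eq0 subr_eq0 (negPf u12).
  by rewrite leNgt (lt_le_trans hM vc).
have [eq_mod|ne_mod] := eqVneq (sqmod c.1) (sqmod c.2).
  have c1_lt1 : `|plane c.1| < 1.
    by rewrite norm_plane_lt1 (le_lt_trans _ Mc) // le_max lexx.
  have c2_lt1 : `|plane c.2| < 1 by rewrite norm_plane_lt1 -eq_mod -norm_plane_lt1.
  have [ec|nc] := eqVneq (plane c.1) (plane c.2).
    have := hder _ c2_lt1; rewrite -divided_difference_diag -[X in divided_difference _ X _]ec.
    by rewrite [divided_difference _ _ _]hc eqxx.
  have eq_norm : `|plane c.1| = `|plane c.2|.
    by rewrite !normc_def /= -/(sqmod c.1) -/(sqmod c.2) eq_mod.
  by have := hcirc _ _ eq_norm c2_lt1 nc; rewrite pc eqxx.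
have [lt12|le21] := ltP (sqmod c.1) (sqmod c.2).
  by apply: (shrink c.1 c.2); rewrite ?norm_plane // le_max lexx orbT.
apply: (shrink c.2 c.1); rewrite ?norm_plane ?le_max ?lexx //.
by rewrite lt_neqAle eq_sym ne_mod.
Qed.

End disk_reduction.

(** * Chords and the Suffridge polynomial *)

Section polar_form.
Variable R : realType.
Implicit Types x y : R.

Definition expi x : R[i] := cos x +i* sin x.

Lemma expiD x y : expi (x + y) = expi x * expi y.
Proof. by rewrite /expi cosD sinD; simpc; congr (_ +i* _); ring. Qed.

Lemma expiX x n : expi x ^+ n = expi (n%:R * x).
Proof.
elim: n => [|n IHn]; first by rewrite mul0r /expi cos0 sin0.
by rewrite exprS IHn -expiD -natr1 mulrDl mul1r addrC.
Qed.

Lemma expiBN x : expi x - expi (- x) = (2 * sin x)%:C * 'i.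
Proof. by rewrite /expi cosN sinN; simpc; congr (_ +i* _); ring. Qed.

Lemma norm_expi x : `|expi x| = 1.
Proof. by rewrite normc_def /= cos2Dsin2 sqrtr1. Qed.

Lemma polar_form (z : R[i]) : exists2 x, - pi <= x <= pi & z = `|z| * expi x.
Proof.
have pi0 := pi_gt0 R; have [->|z0] := eqVneq z 0.
  by exists 0; [lra|rewrite normr0 mul0r].
case: z z0 => a b z0; rewrite normc_def /=.
set r := Num.sqrt _.
have r2 : r ^+ 2 = a ^+ 2 + b ^+ 2 by rewrite sqr_sqrtr // addr_ge0 ?sqr_ge0.
have r0 : 0 < r.
  rewrite lt_def sqrtr_ge0 andbT; apply: contraNneq z0 => r0.
  move: r2; rewrite r0 expr0n /= => /esym/eqP.
  by rewrite paddr_eq0 ?sqr_ge0 // !sqrf_eq0 eq_complex /=.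
pose u := a / r.
have u2 : u ^+ 2 + (b / r) ^+ 2 = 1.
  by rewrite /u !expr_div_n -mulrDl -r2 divff // expf_neq0 // gt_eqF.
have u1 : -1 <= u <= 1 by have := sqr_ge0 (b / r); nra.
have uE : cos (acos u) = u by rewrite acosK // in_itv.
have x0 := acos_ge0 u1; have x1 := acos_lepi u1.
have sE : sin (acos u) = `|b / r|.
  by rewrite sin_acos // -sqrtr_sqr; congr Num.sqrt; lra.
have aE : r * u = a by rewrite mulrC divfK // gt_eqF.
have bE : r * (b / r) = b by rewrite mulrC divfK // gt_eqF.
(* The arccosine only covers the upper half plane; the sign of [b] selects the angle or its
   opposite. *)
have [b0|b0] := ger0P (b / r).
  exists (acos u); first by lra.
  by rewrite /expi uE sE ger0_norm //; simpc; rewrite aE bE.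
exists (- acos u); first by lra.
rewrite /expi cosN sinN uE sE ltr0_norm // opprK.
by simpc; rewrite aE bE.
Qed.

End polar_form.

(** Serves for the derivative. The cubic is [(1 + w) (m + (b - m) w + m w^2)], and [|b - m| <= 2 m]
    puts the zeros of the quadratic on the unit circle. *)
Lemma palindromic_cubic_neq0 (R : rcfType) (m b : R) (w : R[i]) :
  0 < m -> - m <= b <= 3 * m -> `|w| < 1 ->
  m%:C + b%:C * w + b%:C * w ^+ 2 + m%:C * w ^+ 3 != 0.
Proof.
case: w => x y m0 hb; rewrite normc_def /= ltcR => hw.
have {}hw : x ^+ 2 + y ^+ 2 < 1.
  by rewrite -(ltr_sqrt _ ltr01) sqrtr1.
have -> : m%:C + b%:C * (x +i* y) + b%:C * (x +i* y) ^+ 2 + m%:C * (x +i* y) ^+ 3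
  = (1 + (x +i* y)) * (m%:C + (b - m)%:C * (x +i* y) + m%:C * (x +i* y) ^+ 2).
  by rewrite rmorphB /=; ring.
rewrite mulf_neq0 //; apply/eqP; rewrite ?exprS ?expr0 ?mulr1 -?[1]/(1%:C); simpc.
  by case=> *; nra.
case=> hre him.
have : y * (b - m + 2 * m * x) = 0 by lra.
move=> /eqP; rewrite mulf_eq0 => /orP[/eqP y0|/eqP h].
  have /andP[xN1 x1] : -1 < x < 1 by move: hw; rewrite y0; nra.
  have : 0 < m * (1 - x) ^+ 2 by rewrite mulr_gt0 // exprn_gt0 // subr_gt0.
  have : 0 < m * (1 + x) ^+ 2 by rewrite mulr_gt0 // exprn_gt0 //; lra.
  move: hre; rewrite y0; have [x0|/ltW x0] := leP 0 x.
    have : 0 <= x * (b + m) by rewrite mulr_ge0 //; lra.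
    lra.
  have : 0 <= - x * (3 * m - b) by rewrite mulr_ge0 //; lra.
  lra.
have bE : b = m - 2 * m * x by lra.
have : m * (1 - (x ^+ 2 + y ^+ 2)) = 0 by move: hre; rewrite bE; lra.
by move/eqP; rewrite mulf_eq0 gt_eqF //= gt_eqF // subr_gt0.
Qed.

(** * Coefficients, derivative and chords of the polynomial *)

Section suffridge4.
Variables (R : realType) (T : nat).
Hypothesis T_gt0 : (0 < T)%N.
Local Notation t := (T%:R : R).
Local Notation a := (suffridge_a t).
Local Notation n := (3 * t + 1).

(** With [b = pi / (3 t + 2)], the reflection [x -> pi - x] identifies numerators with denominators,
    so the successive products are [a], [a] and 1. As [sin (2 b) = sin (3 t b)], the triple-angle
    formula evaluates [sin (2 b) / sin (t b)]. *)
Lemma suffridge4_coefs :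
  [/\ suffridge_coef R 4 T 2 = (2 * t + 1) * a / n,
      suffridge_coef R 4 T 3 = (t + 1) * a / n &
      suffridge_coef R 4 T 4 = n^-1].
Proof.
have t1 : 1 <= t by rewrite ler1n.
have pi0 := pi_gt0 R.
pose b : R := pi / (3 * t + 2).
have bE : (3 * t + 2) * b = pi by rewrite mulrC divfK // gt_eqF //; lra.
have b0 : 0 < b by rewrite divr_gt0 //; lra.
have tb0 : 0 < t * b by rewrite mulr_gt0 //; lra.
have N_E : (2 + T * 3)%:R = 3 * t + 2 :> R by rewrite natrD natrM; ring.
have D_E : (1 + 3 * T)%:R = n by rewrite natrD natrM; ring.
have angle (x : R) : pi * x / (3 * t + 2) = x * b by rewrite /b; ring.
have sB x : sin (pi - x) = sin x by rewrite sinB sinpi cospi; ring.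
have s1 : sin (t * b) != 0 by rewrite gt_eqF // sin_gt0_pi //; lra.
have s2 : sin (2 * b) != 0 by rewrite gt_eqF // sin_gt0_pi //; lra.
have s2t : sin (2 * t * b) != 0 by rewrite gt_eqF // sin_gt0_pi //; lra.
have n0 : n != 0 by rewrite gt_eqF //; lra.
have aE : sin (2 * b) / sin (t * b) = a.
  have -> : a = 1 + 2 * cos (2 * t * b).
    by rewrite /suffridge_a /b; congr (1 + 2 * cos _); ring.
  apply: (mulIf s1); rewrite divfK //.
  have -> : 2 * b = pi - (t * b + t * b + t * b) by lra.
  have -> : 2 * t * b = t * b + t * b by ring.
  rewrite sB !(sinD, cosD); have := sin2cos2 (t * b).
  move: (sin _) (cos _) => s c s2E.
  rewrite -[s * s]expr2 s2E; apply: etrans (_ : s * (3 * c ^+ 2 - s ^+ 2) = _).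
    by rewrite s2E; ring.
  by rewrite s2E; ring.
have e2 : sin ((2 + t) * b) = sin (2 * t * b) by rewrite -sB; congr sin; lra.
have e3 : sin ((2 + 2 * t) * b) = sin (t * b) by rewrite -sB; congr sin; lra.
have e4 : sin (3 * t * b) = sin (2 * b) by rewrite -sB; congr sin; lra.
rewrite /suffridge_coef /= N_E D_E.
have p1 : \prod_(1 <= k < 2) (sin (pi * (2 + T * k.-1)%:R / (3 * t + 2)) /
    sin (pi * (T * k)%:R / (3 * t + 2))) = a.
  by rewrite big_nat1 /= muln0 addn0 muln1 !angle.
have p2 : \prod_(1 <= k < 3) (sin (pi * (2 + T * k.-1)%:R / (3 * t + 2)) /
    sin (pi * (T * k)%:R / (3 * t + 2))) = a.
  rewrite big_nat_recr //= p1 muln1 !angle natrD natrM [t * 2]mulrC e2 divff //.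
  by rewrite mulr1.
have p3 : \prod_(1 <= k < 4) (sin (pi * (2 + T * k.-1)%:R / (3 * t + 2)) /
    sin (pi * (T * k)%:R / (3 * t + 2))) = 1.
  rewrite big_nat_recr //= p2 !angle natrD !natrM [t * 2]mulrC [t * 3]mulrC.
  by rewrite e3 e4 -aE; field; rewrite s1 s2.
by rewrite p1 p2 p3 !natrM; split; field.
Qed.

Lemma suffridge4E :
  suffridge R 4 T = 'X + ((2 * t + 1) * a / n)%:C *: 'X^(T + 1)
    + ((t + 1) * a / n)%:C *: 'X^(2 * T + 1) + (n^-1)%:C *: 'X^(3 * T + 1).
Proof.
rewrite /suffridge big_nat_recr // big_nat_recr // big_nat1 /= !addrA.
by have [-> -> ->] := suffridge4_coefs; rewrite muln1 [(T * 2)%N]mulnC [(T * 3)%N]mulnC.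
Qed.

Let n_neq0 : n%:C != 0 :> R[i].
Proof.
have t1 : 1 <= t by rewrite ler1n.
by rewrite eq_complex /= eqxx andbT gt_eqF //; lra.
Qed.

Lemma suffridge4_horner z : n%:C * (suffridge R 4 T).[z] =
  n%:C * z + ((2 * t + 1) * a)%:C * z ^+ (T + 1)
  + ((t + 1) * a)%:C * z ^+ (2 * T + 1) + z ^+ (3 * T + 1).
Proof.
have n0 : n != 0 by move: n_neq0; rewrite eq_complex /= eqxx andbT.
have nK (u : R) (y : R[i]) : n%:C * ((u / n)%:C * y) = u%:C * y.
  by rewrite mulrA -rmorphM /= [n * _]mulrC divfK.
have nV (y : R[i]) : n%:C * ((n^-1)%:C * y) = y.
  by rewrite mulrA -rmorphM /= divff // mul1r.
by rewrite suffridge4E !hornerE !mulrDr !nK nV.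
Qed.

(** Times [3 t + 1], the derivative is a palindromic cubic in [z^T] with inner coefficient
    [(t + 1) (2 t + 1) a]. *)
Lemma suffridge4_deriv_neq0 z : `|z| < 1 -> (suffridge R 4 T)^`().[z] != 0.
Proof.
move=> z1; have t1 : 1 <= t by rewrite ler1n.
have /andP[l3 l5] := suffridge_a_bounds t1.
have hb : - n <= (t + 1) * ((2 * t + 1) * a) <= 3 * n by nra.
have hn : 0 < n by lra.
have w1 : `|z ^+ T| < 1 by rewrite normrX exprn_ilt1 // -lt0n.
have := palindromic_cubic_neq0 hn hb w1; apply: contraNneq => dz.
apply/eqP; have := congr1 ( *%R n%:C) dz; rewrite mulr0 => <-.
rewrite suffridge4E !derivD derivX !derivZ !derivXn.
rewrite !hornerD hornerC !hornerZ !hornerMn !hornerXn.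
rewrite !addn1 /= -!exprM ![(T * _)%N]mulnC.
have nK (u : R) (k : nat) (y : R[i]) :
    n%:C * ((u / n)%:C * (y *+ k)) = (k%:R * u)%:C * y.
  rewrite -[y *+ k]mulr_natl !mulrA.
  have -> : k%:R = k%:R%:C :> R[i] by rewrite rmorph_nat.
  by rewrite -!rmorphM /=; congr (_%:C * _); field; rewrite gt_eqF.
have SE k : (k * T).+1%:R = k%:R * t + 1 by rewrite -natr1 natrM.
have S1E : T.+1%:R = t + 1 by rewrite -natr1.
have nV (k : nat) (y : R[i]) :
    n%:C * ((n^-1)%:C * (y *+ k)) = (k%:R : R)%:C * y.
  by rewrite -[n^-1]mul1r nK mulr1.
move: (suffridge_a _) => b.
rewrite 3![n%:C * (_ + _)]mulrDr !nK nV S1E (SE 2%N) (SE 3%N) mulr1.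
by congr (_ + _%:C * _ + _%:C * _ + _%:C * _); ring.
Qed.

(** Write the points as [v e^(i x)] and [v e^(- i x)]. Since [z1^k - z2^k = 2 i sin (k x) v^k], the
    difference of values times [3 t + 1] is [2 i v] times the chord cubic at [v^T]. *)
Lemma suffridge4_circle z1 z2 : `|z1| = `|z2| -> `|z2| < 1 -> z1 != z2 ->
  (suffridge R 4 T).[z1] != (suffridge R 4 T).[z2].
Proof.
move=> eq_norm z2_lt1 z12.
have [x1 hx1 z1E] := polar_form z1; have [x2 hx2 z2E] := polar_form z2.
wlog x21 : z1 z2 x1 x2 eq_norm z2_lt1 z12 hx1 hx2 z1E z2E / x2 <= x1.
  move=> hwlog; have [x21|/ltW x12] := leP x2 x1; first exact: hwlog z1E z2E x21.
  rewrite eq_sym; apply: hwlog z2E z1E x12 => //; last by rewrite eq_sym.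
  by rewrite eq_norm.
pose x := (x1 - x2) / 2; pose v := `|z2| * expi ((x1 + x2) / 2).
have z1v : z1 = v * expi x.
  by rewrite z1E eq_norm /v -mulrA -expiD; congr (_ * expi _); rewrite /x; field.
have z2v : z2 = v * expi (- x).
  by rewrite z2E /v -mulrA -expiD; congr (_ * expi _); rewrite /x; field.
have v0 : v != 0.
  by apply: contraNneq z12 => v0; rewrite z1v z2v v0 !mul0r.
(* Both endpoints would make the two points coincide. *)
have x_itv : 0 < x < pi.
  apply/andP; split.
    rewrite lt_def; apply/andP; split; last by rewrite /x; lra.
    by apply: contraNneq z12 => x0; rewrite z1v z2v x0 oppr0.
  rewrite lt_def; apply/andP; split; last by rewrite /x; lra.
  apply: contraNneq z12 => xpi; rewrite z1v z2v -xpi /expi cosN sinN sinpi.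
  by rewrite oppr0.
have diff k : z1 ^+ k - z2 ^+ k = v ^+ k * ((2 * sin (k%:R * x))%:C * 'i).
  by rewrite z1v z2v !exprMn !expiX mulrN -mulrBr expiBN.
have vT : `|v ^+ T| < 1.
  by rewrite normrX normrM normr_id norm_expi mulr1 exprn_ilt1 // -lt0n.
have := chord_cubic_neq0 T_gt0 x_itv vT; apply: contraNneq => pz.
have : n%:C * (suffridge R 4 T).[z1] - n%:C * (suffridge R 4 T).[z2] = 0.
  by rewrite pz subrr.
rewrite !suffridge4_horner.
have -> : forall b c d z z' k l m, b * z + c * z ^+ k + d * z ^+ l + z ^+ m -
  (b * z' + c * z' ^+ k + d * z' ^+ l + z' ^+ m) = b * (z ^+ 1 - z' ^+ 1)
  + c * (z ^+ k - z' ^+ k) + d * (z ^+ l - z' ^+ l) + (z ^+ m - z' ^+ m) :> R[i].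
  by move=> *; rewrite !expr1; ring.
have SE k : (k * T + 1)%:R = k%:R * t + 1 by rewrite natrD natrM.
have S1E : (T + 1)%:R = t + 1 by rewrite natrD.
rewrite !diff S1E (SE 2%N) (SE 3%N) mul1r => h.
suff : (v * (2%:C * 'i)) * chord_cubic T x (v ^+ T) = 0.
  have c0 : v * (2%:C * 'i) != 0.
    rewrite mulf_neq0 // mulf_neq0 // eq_complex /= ?pnatr_eq0 ?oner_eq0 //.
    by rewrite andbF.
  by move/eqP; rewrite mulf_eq0 (negPf c0).
rewrite -[RHS]h /chord_cubic -!exprM [(T * 2)%N]mulnC [(T * 3)%N]mulnC.
rewrite ![_ ^+ (_ + 1)]exprD !expr1 !rmorphM /=; ring.
Qed.

End suffridge4.

Theorem theorem1 (R : realType) (T : nat) (hT : (1 <= T)%N) :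
  univalent_in_unit_disk (fun z : R[i] => (suffridge R 4 T).[z]).
Proof.
apply: univalent_of_circles.
- rewrite ltnNge; apply/negP => /size1_polyC p_cst.
  have := @suffridge4_deriv_neq0 R T hT 0.
  by rewrite normr0 ltr01 p_cst derivC horner0 eqxx => /(_ isT).
- exact: suffridge4_circle.
- exact: suffridge4_deriv_neq0.
Qed.
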